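(* Let $k$ be a field, $d\in\mathbb{N}$, and let $R=k[x_1,\dots,x_d]$ or $R=k[[x_1,\dots,x_d]]$. There is a surjective group homomorphism $\phi:\mathcal{P}(\mathbb{Z})_t\to\widetilde{g}(R)$ induced by the map $$\phi([P])=\left[\left(\underline{x}^{\underline{\alpha}} \;\middle|\; \underline{\alpha}\in(P_{\mathbb{N}}+\mathbb{R}_+^d)\cap\mathbb{N}^d\right)\right]$$ for $P$ an integral polytope in $\mathbb{R}^d$, where $P_{\mathbb{N}}$ is any translate of $P$ (by an integer vector) with all vertices in $\mathbb{N}^d$.
   Context: Notation: $\mathbb{N}$ includes $0$; $\mathbb{R}_+^d$ is the set of vectors in $\mathbb{R}^d$ with nonnegative coordinates; $\underline{x}^{\underline{\alpha}}=x_1^{\alpha_1}\cdots x_d^{\alpha_d}$ for $\underline{\alpha}\in\mathbb{N}^d$; $(\cdots)$ denotes the ideal of $R$ generated by the listed monomials; $\overline{I}$ is the integral closure of an ideal $I$. Integral polytope group: let $P(\mathbb{Z})$ be the monoid of all (nonempty) bounded closed convex sets in $\mathbb{R}^d$ that are polytopes with all vertices in $\mathbb{Z}^d$ (integral polytopes), under Minkowski addition $A+B=\{a+b : a\in A, b\in B\}$. It is cancellative; let $\mathcal{P}(\mathbb{Z})$ be its Grothendieck group. $\mathcal{P}(\mathbb{Z})_t$ is the quotient group of $\mathcal{P}(\mathbb{Z})$ obtained by identifying polytopes that are translates of one another by vectors of $\mathbb{Z}^d$ (i.e. the quotient by the subgroup generated by the classes of single points of $\mathbb{Z}^d$); $[P]$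 is the class of $P$ in it. The group $\widetilde{g}(R)$: let $ic(R)_{mon}$ be the set of nonzero integrally closed monomial ideals of $R$, a commutative cancellative monoid under $I*J=\overline{IJ}$ with identity $R=(1)$. Put $I\sim J$ if there are monomials $\underline{x}^{\underline{\alpha}},\underline{x}^{\underline{\beta}}$ with $\underline{x}^{\underline{\alpha}}I=\underline{x}^{\underline{\beta}}J$. This is a congruence, and $\widetilde{ic}(R)=ic(R)_{mon}/{\sim}$ is a commutative cancellative monoid; $\widetilde{g}(R)$ is its Grothendieck group, and $[I]$ denotes the class of $I$ in $\widetilde{g}(R)$. *)

(* Defs.v *)
From HB Require Import structures.
From mathcomp Require Import all_boot all_order all_algebra.
From mathcomp Require Import boolp classical_sets reals.
From mathcomp Require Import mpoly zify ring.
Set Implicit Arguments.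
Unset Strict Implicit.
Unset Printing Implicit Defensive.
Import Order.TTheory GRing.Theory Num.Theory.
Local Open Scope ring_scope.
Local Open Scope classical_set_scope.
Local Open Scope quotient_scope.

Section GrothendieckGroup.
Variable M : nmodType.

(* (a, b) stands for the formal difference a - b *)
Definition gro_rel (x y : M * M) : bool :=
  `[< exists c, x.1 + y.2 + c = y.1 + x.2 + c >].

Lemma gro_rel_refl : reflexive gro_rel.
Proof. by move=> x; apply/asboolP; exists 0. Qed.

Lemma gro_rel_sym : ssrbool.symmetric gro_rel.
Proof.
by move=> x y; apply/asboolP/asboolP => -[c e]; exists c; rewrite e.
Qed.

Lemma gro_rel_trans : transitive gro_rel.
Proof.
move=> y x z /asboolP[c e] /asboolP[c' e']; apply/asboolP.
exists (y.1 + y.2 + c + c').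
transitivity ((x.1 + y.2 + c) + (y.1 + z.2 + c')).
  by rewrite [LHS](AC (2*4) ((1*4*5)*(3*2*6))) /=.
by rewrite e e' [LHS](AC (3*3) ((4*2)*(1*5*3*6))) /=.
Qed.

Canonical gro_equiv := EquivRel gro_rel gro_rel_refl gro_rel_sym gro_rel_trans.
Definition grothendieck := {eq_quot gro_equiv}.
HB.instance Definition _ := Choice.on grothendieck.
HB.instance Definition _ := EqQuotient.on grothendieck.

Definition gro_class (a : M) : grothendieck := \pi_grothendieck (a, 0).
Definition gro_zero : grothendieck := \pi_grothendieck (0, 0).
Definition gro_add (x y : grothendieck) : grothendieck :=
  \pi_grothendieck ((repr x).1 + (repr y).1, (repr x).2 + (repr y).2).
Definition gro_opp (x : grothendieck) : grothendieck :=
  \pi_grothendieck ((repr x).2, (repr x).1).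

Lemma gro_repr_rel (x : M * M) :
  exists c, (repr (\pi_grothendieck x)).1 + x.2 + c
          = x.1 + (repr (\pi_grothendieck x)).2 + c.
Proof.
have: repr (\pi_grothendieck x) = x %[mod grothendieck] by rewrite reprK.
by move/eqmodP/asboolP.
Qed.

Lemma gro_pi_eq (x y : M * M) c :
  x.1 + y.2 + c = y.1 + x.2 + c -> \pi_grothendieck x = \pi_grothendieck y.
Proof. by move=> e; apply/eqmodP/asboolP; exists c. Qed.

Lemma gro_add_pi (x y : M * M) :
  gro_add (\pi_grothendieck x) (\pi_grothendieck y) = \pi_grothendieck (x.1 + y.1, x.2 + y.2).
Proof.
have [c e] := gro_repr_rel x; have [c' e'] := gro_repr_rel y.
apply: (@gro_pi_eq _ _ (c + c')) => /=.
rewrite [LHS](AC (2*2*2) ((1*3*5)*(2*4*6))) [RHS](AC (2*2*2) ((1*3*5)*(2*4*6))).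
by rewrite /= e e'.
Qed.

Lemma gro_opp_pi (x : M * M) : gro_opp (\pi_grothendieck x) = \pi_grothendieck (x.2, x.1).
Proof.
have [c e] := gro_repr_rel x; apply: (@gro_pi_eq _ _ c) => /=.
by rewrite (addrC _ x.1) -e (addrC x.2).
Qed.

Lemma groW (P : grothendieck -> Prop) :
  (forall a, P (\pi_grothendieck a)) -> forall x, P x.
Proof. by move=> h x; rewrite -[x]reprK. Qed.

Lemma gro_addA : associative gro_add.
Proof.
elim/groW=> x; elim/groW=> y; elim/groW=> z.
by rewrite !gro_add_pi /= !addrA.
Qed.

Lemma gro_addC : commutative gro_add.
Proof.
elim/groW=> x; elim/groW=> y; rewrite !gro_add_pi.
by congr (\pi_grothendieck (_, _)); rewrite addrC.
Qed.

Lemma gro_add0 : left_id gro_zero gro_add.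
Proof.
elim/groW=> x; rewrite /gro_zero gro_add_pi /= !add0r.
by rewrite -surjective_pairing.
Qed.

Lemma gro_addN : left_inverse gro_zero gro_opp gro_add.
Proof.
elim/groW=> x; rewrite /gro_zero gro_opp_pi gro_add_pi.
by apply: (@gro_pi_eq _ _ 0) => /=; rewrite !addr0 add0r addrC.
Qed.

HB.instance Definition _ :=
  GRing.isZmodule.Build grothendieck gro_addA gro_addC gro_add0 gro_addN.

End GrothendieckGroup.

Section GeneratedSubgroup.
Variables (V : zmodType) (S : set V).

Definition subgroup (H : set V) : Prop :=
  H 0 /\ forall a b, H a -> H b -> H (a - b).

Definition gen_subgroup : {pred V} := fun x => `[< smallest subgroup S x >].

Lemma gen_subgroup_closed : zmod_closed gen_subgroup.
Proof.
split=> [|x y /asboolP hx /asboolP hy]; apply/asboolP => H; first by case=> -[].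
by move=> hH; have [[_ HB] _] := hH; apply: HB; [apply: hx | apply: hy].
Qed.

HB.instance Definition _ :=
  GRing.isZmodClosed.Build V gen_subgroup gen_subgroup_closed.

Definition quot_gen : Type := Quotient.quot gen_subgroup.
HB.instance Definition _ := GRing.Zmodule.on quot_gen.
HB.instance Definition _ := EqQuotient.on quot_gen.
Definition quot_class (x : V) : quot_gen := \pi_quot_gen x.

End GeneratedSubgroup.

Section Polytopes.
Variables (R : realType) (d : nat).
Local Notation vec := 'rV[R]_d.

Definition convex (C : set vec) : Prop :=
  forall x y t, C x -> C y -> 0 <= t <= 1 -> C (t *: x + (1 - t) *: y).

Definition conv_hull (S : set vec) : set vec := smallest convex S.

Definition polytope (P : set vec) : Prop :=
  exists s : seq vec, s != [::] /\ P = conv_hull [set` s].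

(* extreme points; for a polytope these are its 0-dimensional faces *)
Definition vertex (P : set vec) (x : vec) : Prop :=
  P x /\ forall a b t, P a -> P b -> 0 < t < 1 ->
    x = t *: a + (1 - t) *: b -> a = x /\ b = x.

Definition int_vec (z : 'rV[int]_d) : vec := map_mx intr z.
Definition nat_vec (m : 'X_{1..d}) : vec := \row_i (m i)%:R.

Definition integral_polytope (P : set vec) : Prop :=
  polytope P /\ forall x, vertex P x -> exists z, x = int_vec z.

Definition minkowski (P Q : set vec) : set vec :=
  [set x + y | x in P & y in Q].

Definition translate (z : 'rV[int]_d) (P : set vec) : set vec :=
  [set x + int_vec z | x in P].

Definition orthant : set vec := [set x | forall i, 0 <= x 0 i].

Lemma convex_conv_hull S : convex (conv_hull S).
Proof.
by move=> x y t hx hy ht C hC; apply: (hC.1) => //; [apply: hx | apply: hy].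
Qed.

Lemma sub_conv_hull S : S `<=` conv_hull S.
Proof. exact: sub_smallest. Qed.

Lemma conv_hull_min S C : convex C -> S `<=` C -> conv_hull S `<=` C.
Proof. by move=> cC SC x hx; apply: hx. Qed.

Lemma conv_hull_minkowski S T :
  minkowski (conv_hull S) (conv_hull T) = conv_hull (minkowski S T).
Proof.
have comb (t : R) (a b a' b' : vec) :
    t *: (a + a') + (1 - t) *: (b + b') =
    (t *: a + (1 - t) *: b) + (t *: a' + (1 - t) *: b').
  by rewrite !scalerDr addrACA.
have combC (t : R) (a : vec) : t *: a + (1 - t) *: a = a.
  by rewrite -scalerDl addrC subrK scale1r.
apply/seteqP; split; last first.
  apply: conv_hull_min.
    move=> _ _ t [a ha [b hb <-]] [a' ha' [b' hb' <-]] ht.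
    exists (t *: a + (1 - t) *: a'); first exact: convex_conv_hull.
    exists (t *: b + (1 - t) *: b'); first exact: convex_conv_hull.
    by rewrite comb.
  by move=> _ [a ha [b hb <-]]; exists a; [exact: sub_conv_hull|];
     exists b; [exact: sub_conv_hull|].
move=> _ [x hx [y hy <-]].
pose U := [set u : vec | forall b, T b -> conv_hull (minkowski S T) (u + b)].
have Ux : U x.
  apply: conv_hull_min hx => [a a' t ha ha' ht b hb|a ha b hb].
    rewrite -[b in _ + b](combC t) -comb.
    by apply: convex_conv_hull; [apply: ha | apply: ha' |].
  by apply: sub_conv_hull; exists a => //; exists b.
pose W := [set b : vec | conv_hull (minkowski S T) (x + b)].
suff: W y by [].
apply: conv_hull_min hy => [b b' t hb hb' ht|b hb]; last exact: Ux.
by rewrite /W /= -[x in x + _](combC t) -comb; apply: convex_conv_hull.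
Qed.

Lemma polytope_minkowski P Q :
  polytope P -> polytope Q -> polytope (minkowski P Q).
Proof.
move=> [s [s0 ->]] [t [t0 ->]]; exists [seq x + y | x <- s, y <- t]; split.
  by case: s s0 => // a s _; case: t t0.
rewrite conv_hull_minkowski; congr conv_hull; apply/seteqP; split.
  move=> _ [a /= ha [b /= hb <-]]; exact: allpairs_f.
by move=> _ /= /allpairsP[[a b] /= [ha hb ->]]; exists a => //; exists b.
Qed.

Lemma vertex_minkowski P Q x : vertex (minkowski P Q) x ->
  exists p q, [/\ vertex P p, vertex Q q & x = p + q].
Proof.
move=> [[p hp [q hq <-]] hv]; exists p, q; split=> //; split=> //.
  move=> a b t ha hb ht e.
  have [||||/addIr ? /addIr ?] // := hv (a + q) (b + q) t.
  - by exists a => //; exists q.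
  - by exists b => //; exists q.
  by rewrite !scalerDr addrACA -e -scalerDl addrC (addrC t) subrK scale1r addrC.
move=> a b t ha hb ht e.
have [||||/addrI ? /addrI ?] // := hv (p + a) (p + b) t.
- by exists p => //; exists a.
- by exists p => //; exists b.
by rewrite !scalerDr addrACA -e -scalerDl (addrC t) subrK scale1r.
Qed.

Lemma integral_polytope_minkowski P Q : integral_polytope P ->
  integral_polytope Q -> integral_polytope (minkowski P Q).
Proof.
move=> [pP vP] [pQ vQ]; split; first exact: polytope_minkowski.
move=> _ /vertex_minkowski[p [q [/vP[z ->] /vQ[z' ->] ->]]].
by exists (z + z'); rewrite /int_vec map_mxD.
Qed.

Lemma integral_polytope_point z : integral_polytope [set int_vec z].
Proof.
split; last by move=> x [-> _]; exists z.
exists [:: int_vec z]; split=> //; apply/seteqP; split=> [_ ->|].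
  by apply: sub_conv_hull; rewrite /= mem_head.
apply: conv_hull_min => [x y t -> -> _ |x /=]; last by rewrite inE => /eqP.
by rewrite /= -scalerDl addrC subrK scale1r.
Qed.

Record int_polytope := IntPolytope {
  polytope_set :> set vec;
  _ : `[< integral_polytope polytope_set >] }.

HB.instance Definition _ := [isSub for polytope_set].
HB.instance Definition _ := [Choice of int_polytope by <:].

Lemma int_polytopeP (P : int_polytope) : integral_polytope P.
Proof. by case: P => P /= /asboolP. Qed.

Lemma int_polytope_inj (P Q : int_polytope) : P = Q :> set vec -> P = Q.
Proof. exact: val_inj. Qed.

Definition point_polytope (z : 'rV[int]_d) : int_polytope :=
  IntPolytope (asboolT (integral_polytope_point z)).

Definition add_polytope (P Q : int_polytope) : int_polytope :=
  IntPolytope (asboolT (integral_polytope_minkowski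
    (int_polytopeP P) (int_polytopeP Q))).

Lemma add_polytopeA : associative add_polytope.
Proof.
move=> P Q S; apply: int_polytope_inj; apply/seteqP; split.
  move=> _ [p hp [_ [q hq [s hs <-]] <-]]; rewrite addrA.
  by exists (p + q); [exists p => //; exists q | exists s].
move=> _ [_ [p hp [q hq <-]] [s hs <-]]; rewrite -addrA.
by exists p => //; exists (q + s) => //; exists q => //; exists s.
Qed.

Lemma add_polytopeC : commutative add_polytope.
Proof.
move=> P Q; apply: int_polytope_inj; apply/seteqP; split;
  by move=> _ [p hp [q hq <-]]; rewrite addrC; exists q => //; exists p.
Qed.

Lemma add_polytope0 : left_id (point_polytope 0) add_polytope.
Proof.
have e0 : int_vec 0 = 0 by rewrite /int_vec map_mx0.
move=> P; apply: int_polytope_inj; apply/seteqP; split.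
  by move=> _ [_ -> [q hq <-]]; rewrite e0 add0r.
by move=> x hx; exists 0; rewrite ?e0 //; exists x; rewrite ?add0r.
Qed.

HB.instance Definition _ := GRing.isNmodule.Build int_polytope
  add_polytopeA add_polytopeC add_polytope0.

Definition polytope_group := grothendieck int_polytope.

Definition polytope_group_t : Type := quot_gen
  [set gro_class (point_polytope z) | z in [set: 'rV[int]_d]].
HB.instance Definition _ := GRing.Zmodule.on polytope_group_t.

Definition polytope_class (P : int_polytope) : polytope_group_t :=
  quot_class _ (gro_class P).

End Polytopes.
Section PowerSeries.
Variables (d : nat) (k : comNzRingType).
Local Notation E := 'X_{1..d}.

Record mpseries := MPSeries { pscoef : E -> k }.

Lemma mpseriesP f g : pscoef f =1 pscoef g -> f = g.
Proof. by case: f g => f [g] /= /funext ->. Qed.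

HB.instance Definition _ := gen_eqMixin mpseries.
HB.instance Definition _ := gen_choiceMixin mpseries.

Definition cauchy (f g : E -> k) (m : E) : k :=
  \sum_(p : 'X_{1..d < (mdeg m).+1, (mdeg m).+1} | m == (p.1 + p.2)%MM)
     f p.1 * g p.2.

Definition ps_zero := MPSeries (fun=> 0).
Definition ps_one := MPSeries (fun m => (m == 0%MM)%:R).
Definition ps_opp f := MPSeries (fun m => - pscoef f m).
Definition ps_add f g := MPSeries (fun m => pscoef f m + pscoef g m).
Definition ps_mul f g := MPSeries (cauchy (pscoef f) (pscoef g)).

Lemma ps_addA : associative ps_add.
Proof. by move=> f g h; apply: mpseriesP => m /=; rewrite addrA. Qed.
Lemma ps_addC : commutative ps_add.
Proof. by move=> f g; apply: mpseriesP => m /=; rewrite addrC. Qed.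
Lemma ps_add0 : left_id ps_zero ps_add.
Proof. by move=> f; apply: mpseriesP => m /=; rewrite add0r. Qed.
Lemma ps_addN : left_inverse ps_zero ps_opp ps_add.
Proof. by move=> f; apply: mpseriesP => m /=; rewrite addNr. Qed.

HB.instance Definition _ :=
  GRing.isZmodule.Build mpseries ps_addA ps_addC ps_add0 ps_addN.

(* The ring axioms are inherited from polynomials by truncation. *)
Definition ps_trunc n (f : E -> k) : {mpoly k[d]} :=
  \sum_(m : 'X_{1..d < n}) f m *: 'X_[m].

Lemma trunc_coef n f m : (mdeg m < n)%N -> (ps_trunc n f)@_m = f m.
Proof. exact: mcoeff_mpoly. Qed.

Lemma cauchy_coef (p q : {mpoly k[d]}) f g m :
  (forall u, (mdeg u <= mdeg m)%N -> p@_u = f u) ->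
  (forall u, (mdeg u <= mdeg m)%N -> q@_u = g u) ->
  cauchy f g m = (p * q)@_m.
Proof.
move=> pf qg; rewrite mcoeffM; apply: eq_bigr => -[[u hu] [v hv]] /= _.
by rewrite pf ?qg.
Qed.

Lemma cauchy_trunc n f g m : (mdeg m < n)%N ->
  cauchy f g m = (ps_trunc n f * ps_trunc n g)@_m.
Proof.
by move=> mn; apply: cauchy_coef => u um; rewrite trunc_coef ?(leq_ltn_trans um).
Qed.

Lemma ps_mulA : associative ps_mul.
Proof.
move=> f g h; apply: mpseriesP => m /=; set n := (mdeg m).+1.
have tr u : (mdeg u <= mdeg m)%N -> (mdeg u < n)%N by [].
rewrite (@cauchy_coef (ps_trunc n (pscoef f))
   (ps_trunc n (pscoef g) * ps_trunc n (pscoef h))).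
- rewrite mulrA; apply/esym/cauchy_coef => u /tr un; last exact: trunc_coef.
  by rewrite (cauchy_trunc _ _ un).
- by move=> u /tr; exact: trunc_coef.
- by move=> u /tr un; rewrite (cauchy_trunc _ _ un).
Qed.

Lemma ps_mulC : commutative ps_mul.
Proof.
move=> f g; apply: mpseriesP => m /=.
by rewrite !(cauchy_trunc _ _ (ltnSn _)) mulrC.
Qed.

Lemma ps_mul1 : left_id ps_one ps_mul.
Proof.
move=> f; apply: mpseriesP => m /=.
rewrite (@cauchy_coef 1 (ps_trunc (mdeg m).+1 (pscoef f))) ?mul1r ?trunc_coef //.
  by move=> u _; rewrite mcoeff1.
by move=> u um; rewrite trunc_coef.
Qed.

Lemma ps_mulD : left_distributive ps_mul ps_add.
Proof.
move=> f g h; apply: mpseriesP => m /=.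
rewrite (@cauchy_coef (ps_trunc (mdeg m).+1 (pscoef f) +
    ps_trunc (mdeg m).+1 (pscoef g)) (ps_trunc (mdeg m).+1 (pscoef h))).
- by rewrite mulrDl mcoeffD !(cauchy_trunc _ _ (ltnSn _)).
- by move=> u um; rewrite mcoeffD !trunc_coef.
- by move=> u um; rewrite trunc_coef.
Qed.

Lemma ps_one_neq0 : ps_one != 0.
Proof.
apply/eqP => /(congr1 (fun f => pscoef f 0%MM)) /eqP /=.
by rewrite eqxx oner_eq0.
Qed.

HB.instance Definition _ := GRing.Zmodule_isComNzRing.Build mpseries
  ps_mulA ps_mulC ps_mul1 ps_mulD ps_one_neq0.

End PowerSeries.

(* A ring whose elements are determined by their coefficients, multiplied by *)
(* the Cauchy rule, which contains the monomials and is stable under keeping *)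
(* only some of the terms and under dividing by a monomial the terms which   *)
(* it divides. It is used to treat polynomials and power series uniformly.   *)
Record coef_ring (k : fieldType) (d : nat) := CoefRing {
  cr_sort :> comNzRingType;
  cr_coef : cr_sort -> 'X_{1..d} -> k;
  cr_mon : 'X_{1..d} -> cr_sort;
  cr_coef_inj : forall f g, cr_coef f =1 cr_coef g -> f = g;
  cr_coefD : forall f g m, cr_coef (f + g) m = cr_coef f m + cr_coef g m;
  cr_coefM : forall f g m, cr_coef (f * g) m = cauchy (cr_coef f) (cr_coef g) m;
  cr_coef1 : forall m, cr_coef 1 m = (m == 0%MM)%:R;
  cr_coef_mon : forall u m, cr_coef (cr_mon u) m = (u == m)%:R;
  cr_restrict : forall (p : pred 'X_{1..d}) f,
    exists g, forall m, cr_coef g m = if p m then cr_coef f m else 0;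
  cr_shift : forall u f, exists g, forall m, cr_coef g m = cr_coef f (m + u)%MM }.

Section Instances.
Variables (k : fieldType) (d : nat).

Lemma mpoly_of_finite_support n (F : 'X_{1..d} -> k) :
  (forall m, (n <= mdeg m)%N -> F m = 0) ->
  exists g : {mpoly k[d]}, forall m, g@_m = F m.
Proof.
move=> F0; exists (ps_trunc n F) => m; case: (ltnP (mdeg m) n) => mn.
  exact: trunc_coef.
rewrite F0 // raddf_sum big1 //= => -[u un] _ /=.
rewrite mcoeffZ mcoeffX; case: eqP => [um|]; last by rewrite mulr0.
by rewrite -um leqNgt un in mn.
Qed.

Lemma mcoeff_large (f : {mpoly k[d]}) m : (msize f <= mdeg m)%N -> f@_m = 0.
Proof. by move=> /msize_mdeg_ge /memN_msupp_eq0. Qed.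

Lemma poly_restrict (p : pred 'X_{1..d}) (f : {mpoly k[d]}) :
  exists g : {mpoly k[d]}, forall m, g@_m = if p m then f@_m else 0.
Proof.
apply: (@mpoly_of_finite_support (msize f)) => m /mcoeff_large ->.
by case: ifP.
Qed.

Lemma poly_shift u (f : {mpoly k[d]}) :
  exists g : {mpoly k[d]}, forall m, g@_m = f@_(m + u).
Proof.
apply: (@mpoly_of_finite_support (msize f)) => m fm; apply: mcoeff_large.
by rewrite mdegD (leq_trans fm) // leq_addr.
Qed.

Definition polynomial_ring : coef_ring k d :=
  @CoefRing k d {mpoly k[d]} (fun f m => f@_m) (fun u => 'X_[u])
    (fun f g => (mpolyP f g).1) (fun f g m => mcoeffD m f g)
    (@mcoeffM d k) (@mcoeff1 d k) (@mcoeffX d k) poly_restrict poly_shift.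

Lemma series_restrict (p : pred 'X_{1..d}) (f : mpseries d k) :
  exists g : mpseries d k, forall m,
    pscoef g m = if p m then pscoef f m else 0.
Proof. by exists (MPSeries (fun m => if p m then pscoef f m else 0)). Qed.

Lemma series_shift u (f : mpseries d k) :
  exists g : mpseries d k, forall m, pscoef g m = pscoef f (m + u)%MM.
Proof. by exists (MPSeries (fun m => pscoef f (m + u)%MM)). Qed.

Definition power_series_ring : coef_ring k d :=
  @CoefRing k d (mpseries d k) (@pscoef d k)
    (fun u => MPSeries (fun m => (u == m)%:R))
    (@mpseriesP d k) (fun f g m => erefl) (fun f g m => erefl)
    (fun m => erefl) (fun u m => erefl) series_restrict series_shift.

End Instances.
Section Exponents.
Variable d : nat.
Local Notation E := 'X_{1..d}.
Implicit Types (D F : set E) (m u v x y : E).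

Definition up D : set E := [set m | exists2 e, D e & (e <= m)%MM].

(* the exponents of the monomials lying in the n-th power of (x^u | u in D) *)
Fixpoint nfold D n : set E :=
  if n is n'.+1 then
    [set m | exists e m', [/\ D e, nfold D n' m' & m = (e + m')%MM]]
  else setT.

(* x^m is integral over (x^u | u in D) iff some power x^(m n) lies in the n-th *)
(* power of this ideal; sat D is therefore the exponent set of the closure.   *)
Definition sat D : set E :=
  [set m | exists n, (0 < n)%N /\ nfold D n (m *+ n)%MM].

Definition exp_add D F : set E := [set m | exists u v, [/\ D u, F v & m = (u + v)%MM]].

Definition shift_exp u D : set E := [set m | exists2 e, D e & m = (u + e)%MM].

Lemma le_exists u m : (u <= m)%MM -> exists v, m = (u + v)%MM.
Proof. by move=> um; exists (m - u)%MM; rewrite addmC submK. Qed.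

Lemma upP D m : up D m <-> exists e v, D e /\ m = (e + v)%MM.
Proof.
split=> [[e De /le_exists[v ->]]|[e [v [De ->]]]]; first by exists e, v.
by exists e => //; exact: lem_addr.
Qed.

Lemma nfold1 D : nfold D 1 = up D.
Proof.
apply/seteqP; split=> m; first by move=> [e [v [De _ ->]]]; apply/upP; exists e, v.
by move=> /upP[e [v [De ->]]]; exists e, v.
Qed.

Lemma nfold_up D n m v : nfold D n m -> nfold D n (m + v)%MM.
Proof.
elim: n m => [//|n IH] _ [e [m [De hm ->]]].
by exists e, (m + v)%MM; rewrite addmA; split=> //; apply: IH.
Qed.

Lemma nfoldD D n p m m' :
  nfold D n m -> nfold D p m' -> nfold D (n + p) (m + m')%MM.
Proof.
elim: n m => [|n IH] m; first by move=> _ h; rewrite addmC; exact: nfold_up.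
move=> [e [m1 [De hm ->]]] h; exists e, (m1 + m')%MM.
by rewrite addmA; split=> //; apply: IH.
Qed.

Lemma nfold_mul D n p m : nfold D n m -> nfold D (n * p) (m *+ p)%MM.
Proof.
move=> h; elim: p => [|p IH]; first by rewrite muln0.
by rewrite mulnS mulmS; exact: nfoldD.
Qed.

Lemma nfold_sub D F n : D `<=` F -> nfold D n `<=` nfold F n.
Proof.
move=> DF; elim: n => [//|n IH] m [e [m' [De hm ->]]].
by exists e, m'; split; [apply: DF | apply: IH |].
Qed.

Lemma nfold_le D n p m : (n <= p)%N -> nfold D p m -> nfold D n m.
Proof.
elim: n p m => [//|n IH] [//|p] m np [e [m' [De hm ->]]].
by exists e, m'; split=> //; apply: IH hm.
Qed.

Lemma sat_sub D F : D `<=` F -> sat D `<=` sat F.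
Proof. by move=> DF m [n [n0 h]]; exists n; split=> //; exact: nfold_sub h. Qed.

Lemma sub_sat D : D `<=` sat D.
Proof.
by move=> m Dm; exists 1%N; split=> //; exists m, 0%MM; rewrite mulm1n addm0.
Qed.

Lemma sat_upP D m v : sat D m -> sat D (m + v)%MM.
Proof.
move=> [n [n0 h]]; exists n; split=> //.
suff -> : ((m + v) *+ n = m *+ n + v *+ n)%MM by exact: nfold_up.
by apply/mnmP => i; rewrite !(mulmnE, mnmDE) mulnDl.
Qed.

Lemma up_sat D : up (sat D) = sat D.
Proof.
apply/seteqP; split=> m; first by move=> /upP[e [v [h ->]]]; exact: sat_upP.
by move=> h; exists m => //; exact: lepm_refl.
Qed.

Lemma nfold_sat D n m : nfold (sat D) n m ->
  exists p, (0 < p)%N /\ nfold D (p * n) (m *+ p)%MM.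
Proof.
elim: n m => [|n IH] m; first by move=> _; exists 1%N.
move=> [e [m' [[p [p0 he]] /IH[q [q0 hq]] ->]]].
exists (p * q)%N; rewrite muln_gt0 p0 q0; split=> //.
have -> : (p * q * n.+1 = p * q + q * n * p)%N by nia.
have -> : ((e + m') *+ (p * q) = e *+ p *+ q + m' *+ q *+ p)%MM.
  by apply/mnmP => i; rewrite !(mulmnE, mnmDE); nia.
by apply: nfoldD; apply: nfold_mul.
Qed.

Lemma sat_sat D : sat (sat D) = sat D.
Proof.
apply/seteqP; split; last exact: sub_sat.
move=> m [n [n0 /nfold_sat[p [p0 h]]]]; exists (p * n)%N.
rewrite muln_gt0 p0 n0; split=> //.
suff -> : (m *+ (p * n) = m *+ n *+ p)%MM by [].
by apply/mnmP => i; rewrite !mulmnE; nia.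
Qed.

Lemma sat_min D F : D `<=` sat F -> sat D `<=` sat F.
Proof. by move=> /sat_sub; rewrite sat_sat. Qed.

Lemma exp_addC D F : exp_add D F = exp_add F D.
Proof.
by apply/seteqP; split=> _ [u [v [hu hv ->]]]; exists v, u; rewrite addmC.
Qed.

Lemma exp_addA D F G : exp_add D (exp_add F G) = exp_add (exp_add D F) G.
Proof.
apply/seteqP; split=> m.
  move=> [u [_ [hu [v [w [hv hw ->]]] ->]]]; exists (u + v)%MM, w.
  by rewrite addmA; split=> //; exists u, v.
move=> [_ [w [[u [v [hu hv ->]]] hw ->]]]; exists u, (v + w)%MM.
by rewrite addmA; split=> //; exists v, w.
Qed.

Lemma nfold_exp_add D F n m m' :
  nfold D n m -> nfold F n m' -> nfold (exp_add D F) n (m + m')%MM.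
Proof.
elim: n m m' => [//|n IH] _ _ [e [m [De hm ->]]] [f [m' [Ff hm' ->]]].
exists (e + f)%MM, (m + m')%MM; split; [by exists e, f | exact: IH |].
by apply/mnmP => i; rewrite !mnmDE; lia.
Qed.

Lemma exp_add_satl D F : exp_add (sat D) F `<=` sat (exp_add D F).
Proof.
move=> _ [u [v [[n [n0 hu]] Fv ->]]]; exists n; split=> //.
have -> : ((u + v) *+ n = u *+ n + v *+ n)%MM.
  by apply/mnmP => i; rewrite !(mulmnE, mnmDE) mulnDl.
apply: nfold_exp_add => //; rewrite -[n in nfold F n]mul1n; apply: nfold_mul.
by exists v, 0%MM; rewrite addm0.
Qed.

Lemma sat_exp_add_satl D F : sat (exp_add (sat D) F) = sat (exp_add D F).
Proof.
apply/seteqP; split; first by apply: sat_min; exact: exp_add_satl.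
by apply: sat_sub => _ [u [v [hu hv ->]]]; exists u, v; split=> //; exact: sub_sat.
Qed.

Lemma sat_exp_add_satr D F : sat (exp_add D (sat F)) = sat (exp_add D F).
Proof. by rewrite exp_addC sat_exp_add_satl exp_addC. Qed.

Lemma exp_add_shift u D F : exp_add (shift_exp u D) F = shift_exp u (exp_add D F).
Proof.
apply/seteqP; split=> m.
  by move=> [_ [v [[w hw ->] hv ->]]]; exists (w + v)%MM; rewrite ?addmA //; exists w, v.
move=> [_ [w [v [hw hv ->]]] ->]; exists (u + w)%MM, v.
by rewrite addmA; split=> //; exists w.
Qed.

Lemma shift_expD u v D : shift_exp u (shift_exp v D) = shift_exp (u + v)%MM D.
Proof.
apply/seteqP; split=> m; first by move=> [_ [w hw ->] ->]; exists w; rewrite ?addmA.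
by move=> [w hw ->]; exists (v + w)%MM; rewrite ?addmA //; exists w.
Qed.

Lemma nfold_shift u D n m : nfold (shift_exp u D) n m ->
  exists2 y, nfold D n y & m = (u *+ n + y)%MM.
Proof.
elim: n m => [|n IH] m; first by exists m; rewrite // mulm0n add0m.
move=> [_ [m' [[e De ->] /IH[y hy ->] ->]]]; exists (e + y)%MM; first by exists e, y.
by apply/mnmP => i; rewrite !(mnmDE, mulmnE); nia.
Qed.

Lemma shift_nfold u D n m :
  nfold D n m -> nfold (shift_exp u D) n (u *+ n + m)%MM.
Proof.
elim: n m => [//|n IH] _ [e [m [De hm ->]]].
exists (u + e)%MM, (u *+ n + m)%MM; split; [by exists e | exact: IH |].
by apply/mnmP => i; rewrite !(mnmDE, mulmnE); nia.
Qed.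

Lemma sat_shift u D : sat (shift_exp u D) = shift_exp u (sat D).
Proof.
apply/seteqP; split=> m.
  move=> [n [n0 /nfold_shift[y hy e]]].
  have um : (u <= m)%MM.
    apply/mnm_lepP => i; move/mnmP/(_ i): e; rewrite !(mnmDE, mulmnE) => e.
    by rewrite -(leq_pmul2r n0) e leq_addr.
  move/le_exists: um e => [w ->] e; exists w => //; exists n; split=> //.
  suff -> : (w *+ n)%MM = y by [].
  apply/mnmP => i; move/mnmP/(_ i): e; rewrite !(mnmDE, mulmnE); nia.
move=> [w [n [n0 hw]] ->]; exists n; split=> //.
have -> : ((u + w) *+ n = u *+ n + w *+ n)%MM.
  by apply/mnmP => i; rewrite !(mulmnE, mnmDE) mulnDl.
exact: shift_nfold.
Qed.

Lemma dickson_seq n (D : set (seq nat)) : (forall s, D s -> size s = n) ->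
  exists l : seq (seq nat), (forall s, s \in l -> D s) /\
    forall s, D s -> exists2 t, t \in l & all2 leq t s.
Proof.
elim: n D => [|n IH] D hD.
  have [D0|D0] := pselect (D [::]).
    exists [:: [::]]; split=> [s|s /hD/size0nil ->]; first by rewrite inE => /eqP ->.
    by exists [::].
  by exists [::]; split=> // s hs; case: D0; have/size0nil <- := hD _ hs.
have slice a : exists l : seq (seq nat), (forall s, s \in l -> D (a :: s)) /\
    forall s, D (a :: s) -> exists2 t, t \in l & all2 leq t s.
  by apply: (IH (fun s => D (a :: s))) => s /hD [].
have [l [lD Dl]] := IH (fun s => exists a, D (a :: s)) (fun s '(ex_intro a h) =>
  succn_inj (hD _ h)).
have [B [l' [l'D Bl]]] : exists B (l' : seq (seq nat)), (forall s, s \in l' -> D s) /\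
    forall s, s \in l -> exists2 a, (a <= B)%N & (a :: s) \in l'.
  elim: l lD {Dl} => [|s l IHl] lD; first by exists 0%N, [::].
  have [a ha] := lD s (mem_head _ _).
  have [|B [l' [h1 h2]]] := IHl; first by move=> t ht; apply: lD; rewrite inE ht orbT.
  exists (maxn a B), ((a :: s) :: l'); split=> t; rewrite !inE.
    by case/orP => [/eqP ->|/h1].
  case/orP => [/eqP ->|/h2[b bB hb]]; first by exists a; rewrite ?leq_maxl // mem_head.
  by exists b; rewrite ?inE ?hb ?orbT // (leq_trans bB) ?leq_maxr.
have [l2 [l2D hl2]] : exists l2 : seq (seq nat), (forall s, s \in l2 -> D s) /\
    forall a s, (a < B)%N -> D (a :: s) -> exists2 t, t \in l2 & all2 leq t (a :: s).
  elim: B {Bl} => [|b [l2 [h1 h2]]]; first by exists [::].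
  have [l3 [h3 h4]] := slice b.
  exists ([seq b :: t | t <- l3] ++ l2); split.
    by move=> s; rewrite mem_cat => /orP[/mapP[t /h3 ? ->]|/h1].
  move=> a s; rewrite ltnS leq_eqVlt => /orP[/eqP -> /h4[t tl ts]|ab /(h2 _ _ ab)[t tl ts]].
    by exists (b :: t); rewrite /= ?leqnn // mem_cat map_f.
  by exists t; rewrite // mem_cat tl orbT.
exists (l' ++ l2); split=> [s|[/hD //|a s] ha].
  by rewrite mem_cat => /orP[/l'D|/l2D].
have [/hl2/(_ ha)[t tl ts]|Ba] := ltnP a B.
  by exists t; rewrite // mem_cat tl orbT.
have [t tl ts] := Dl s (ex_intro _ a ha).
have [b bB hb] := Bl t tl; exists (b :: t); first by rewrite mem_cat hb.
by rewrite /= ts (leq_trans bB).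
Qed.

Lemma dickson D : exists l : seq E, (forall m, m \in l -> D m) /\ D `<=` up [set` l].
Proof.
have [|l [lD Dl]] := @dickson_seq d [set val (val m) | m in D].
  by move=> _ [m _ <-]; rewrite size_tuple.
have [l' [l'D hl']] : exists l' : seq E, (forall m, m \in l' -> D m) /\
    forall s, s \in l -> exists2 m, m \in l' & val (val m) = s.
  elim: l lD {Dl} => [|s l IHl] lD; first by exists [::].
  have [m Dm ms] := lD s (mem_head _ _).
  have [|l' [h1 h2]] := IHl; first by move=> t ht; apply: lD; rewrite inE ht orbT.
  exists (m :: l'); split=> t; rewrite !inE; first by case/orP => [/eqP ->|/h1].
  case/orP => [/eqP ->|/h2[u hu <-]]; first by exists m; rewrite ?mem_head.
  by exists u; rewrite // inE hu orbT.
exists l'; split=> // m Dm; have [|s /hl'[u ul <-] us] := Dl (val (val m)).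
  by exists m.
exists u => //; apply/mnm_lepP => i.
rewrite !(mnm_nth 0%N) /=.
move: us; rewrite all2E => /andP[/eqP su /(all_nthP (0, 0)%N)/(_ i)].
by rewrite size_zip su minnn size_tuple ltn_ord nth_zip //; apply.
Qed.

Lemma nfold_U1 a D n m : nfold (a |` D) n m ->
  exists p q y, [/\ (p + q = n)%N, nfold D q y & m = (a *+ p + y)%MM].
Proof.
elim: n m => [|n IH] m; first by exists 0%N, 0%N, m; rewrite mulm0n add0m.
move=> [e [m' [he /IH[p [q [y [<- hy ->]]]] ->]]].
case: he => [->|he]; first by exists p.+1, q, y; rewrite mulmS addmA.
exists p, q.+1, (e + y)%MM; rewrite addnS; split=> //; first by exists e, y.
by apply/mnmP => i; rewrite !mnmDE; lia.
Qed.

Lemma extremal a D n x y : ~ sat D a ->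
  sat (a |` D) x -> nfold (sat (a |` D)) n y -> (a *+ n.+1 = x + y)%MM -> x = a.
Proof.
move=> aD [N [N0 /nfold_U1[p [q [z [pq hz xz]]]]]].
move=> /nfold_sat[N' [N'0 /nfold_U1[p' [q' [z' [pq' hz' yz]]]]]] e.
have [q0|q0] := posnP (q * N' + q' * N)%N.
  have [q_0 q'_0] : q = 0%N /\ q' = 0%N by split; nia.
  apply/mnmP => i; move/mnmP/(_ i): e; move/mnmP/(_ i): xz; move/mnmP/(_ i): yz.
  rewrite !(mnmDE, mulmnE) => e1 e2 e3.
  apply/eqP; rewrite -(eqn_pmul2r N0) e2; apply/eqP.
  have pN : p = N by lia.
  have p'N : p' = (N' * n)%N by rewrite -pq' q'_0 addn0.
  rewrite p'N in e1; rewrite pN in e2 *.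
  have h : (a i * n.+1 * (N * N') =
      (a i * N + z i) * N' + (a i * (N' * n) + z' i) * N)%N.
    by rewrite -e1 -e2 e3; ring.
  have {}h : (a i * n.+1 * (N * N') + (z i * N' + z' i * N) =
      a i * n.+1 * (N * N') + 0)%N.
    by rewrite addn0 {2}h; ring.
  by move/addnI/eqP: h; rewrite addn_eq0 !muln_eq0 => /andP[h _]; nia.
case: aD; exists (q * N' + q' * N)%N; split=> //.
suff -> : (a *+ (q * N' + q' * N) = z *+ N' + z' *+ N)%MM.
  by apply: nfoldD; apply: nfold_mul.
apply/mnmP => i; move/mnmP/(_ i): e; move/mnmP/(_ i): xz; move/mnmP/(_ i): yz.
rewrite !(mnmDE, mulmnE) => e1 e2 e3.
apply: (@addnI (a i * (p * N' + p' * N))%N).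
transitivity (a i * n.+1 * (N * N'))%N.
  transitivity (a i * ((p + q) * N' + (p' + q') * N))%N; first by ring.
  by rewrite pq pq'; ring.
transitivity (x i * N * N' + y i * N' * N)%N; first by rewrite e3; ring.
by rewrite e1 e2; ring.
Qed.

(* If F is not in the saturation of D, there is an extremal exponent of F *)
(* which is not in D. *)
Lemma exists_extremal D F (l : seq E) :
  (forall m, m \in l -> F m) -> F `<=` sat (D `|` [set` l]) ->
  F `<=` sat D \/
  exists a D', [/\ F a, ~ D a, ~ sat D' a, D `<=` D' & F `<=` sat (a |` D')].
Proof.
elim: l => [|a l IH] lF Fl; first by left; rewrite set_nil setU0 in Fl.
have lF' m : m \in l -> F m by move=> ml; apply: lF; rewrite inE ml orbT.
have [ha|ha] := pselect (sat (D `|` [set` l]) a).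
  apply: IH => //; apply: subset_trans Fl _; apply: sat_min => m.
  case=> [Dm|/=]; first by apply: sub_sat; left.
  by rewrite inE => /orP[/eqP -> //|ml]; apply: sub_sat; right.
right; exists a, (D `|` [set` l]); split=> //.
- by apply: lF; rewrite mem_head.
- by move=> Da; apply: ha; apply: sub_sat; left.
- apply: subset_trans Fl _; apply: sat_sub => m [Dm|/=]; first by right; left.
  by rewrite inE => /orP[/eqP ->|ml]; [left|right; right].
Qed.

Lemma nfold_pigeonhole (l : seq E) N n m :
  nfold [set` l] n m -> (size l * N < n)%N ->
  exists g y, [/\ g \in l, nfold [set` l] (n - N) y & m = (g *+ N + y)%MM].
Proof.
elim: l n m => [|g l IH] n m.
  by case: n => // n [e [m' []]].
move=> h ln.
have hs : nfold (g |` [set` l]) n m.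
  by apply: nfold_sub h => u /=; rewrite inE => /orP[/eqP ->|]; [left|right].
have [p [q [y [pq hy ->]]]] := nfold_U1 hs.
have ll' : [set` l] `<=` [set` g :: l] by move=> u /= ul; rewrite inE ul orbT.
have gp r : nfold [set` g :: l] r (g *+ r)%MM.
  elim: r => // r hr; exists g, (g *+ r)%MM; rewrite mulmS; split=> //.
  by rewrite /= mem_head.
have [Np|pN] := leqP N p.
  exists g, (g *+ (p - N) + y)%MM; split; first exact: mem_head.
    have -> : (n - N = (p - N) + q)%N by lia.
    by apply: nfoldD => //; exact: nfold_sub hy.
  by apply/mnmP => i; rewrite !(mnmDE, mulmnE); nia.
have [|g' [y' [gl hy' ->]]] := IH q y hy; first by move: ln => /=; nia.
exists g', (g *+ p + y')%MM; split; first by rewrite inE gl orbT.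
  have l0 : (0 < size l)%N by case: (l) gl.
  have -> : (n - N = p + (q - N))%N by move: ln => /=; nia.
  by apply: nfoldD => //; exact: nfold_sub hy'.
by apply/mnmP => i; rewrite !mnmDE; lia.
Qed.

Lemma sat_reduction D : exists n, forall m,
  nfold (sat D) n.+1 m -> exists e m', [/\ D e, nfold (sat D) n m' & m = (e + m')%MM].
Proof.
have [l [lD Dl]] := dickson (sat D).
have [N [N0 hN]] : exists N, (0 < N)%N /\
    forall g, g \in l -> nfold D N (g *+ N)%MM.
  elim: l lD {Dl} => [|g l IHl] lD; first by exists 1%N.
  have [p [p0 hp]] := lD g (mem_head _ _).
  have [|N [N0 hN]] := IHl; first by move=> t ht; apply: lD; rewrite inE ht orbT.
  exists (p * N)%N; rewrite muln_gt0 p0; split=> // u; rewrite inE => /orP[/eqP ->|/hN h].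
    suff -> : (g *+ (p * N) = g *+ p *+ N)%MM by exact: nfold_mul.
    by apply/mnmP => i; rewrite !mulmnE mulnA.
  suff -> : (u *+ (p * N) = u *+ N *+ p)%MM by rewrite mulnC; exact: nfold_mul.
  by apply/mnmP => i; rewrite !mulmnE; nia.
exists (size l * N + N)%N => m hm.
have hl : nfold [set` l] (size l * N + N).+1 m.
  elim: (_.+1) m hm => [//|n IH] _ [e [m [/Dl/upP[g [v [gl ->]]] hm ->]]].
  exists g, (v + m)%MM; rewrite addmA; split=> //; rewrite addmC.
  by apply: nfold_up; exact: IH.
have [|g [y [gl hy ->]]] := nfold_pigeonhole (N := N) hl; first by lia.
case: N N0 hN hl hy {hm} => // N _ hN _ hy.
have [e [z [De hz ->]]] := hN g gl.
exists e, (z + y)%MM; rewrite addmA; split=> //.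
have -> : (size l * N.+1 + N.+1 = N + ((size l * N.+1 + N.+1).+1 - N.+1))%N by lia.
apply: nfoldD; first by apply: nfold_sub hz; exact: sub_sat.
by apply: nfold_sub hy => u; exact: lD.
Qed.

End Exponents.
Section Ideals.
Variable A : comNzRingType.
Implicit Types (I J S : set A) (x y : A).

Definition ideal I : Prop :=
  [/\ I 0, forall x y, I x -> I y -> I (x + y) & forall a x, I x -> I (a * x)].

Definition ideal_gen S : set A := smallest ideal S.

Definition ideal_mul I J : set A := ideal_gen [set x * y | x in I & y in J].

Fixpoint ideal_exp I n : set A :=
  if n is n'.+1 then ideal_mul I (ideal_exp I n') else setT.

Definition integral_closure I : set A :=
  [set r | exists n (a : nat -> A), [/\ (0 < n)%N,
     forall i, (0 < i <= n)%N -> ideal_exp I i (a i) &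
     r ^+ n + \sum_(1 <= i < n.+1) a i * r ^+ (n - i) = 0]].

Lemma ideal_genP S : ideal (ideal_gen S).
Proof.
split=> [J [[J0 _ _] _] //|x y hx hy J hJ|a x hx J hJ].
  by have [[_ JD _] _] := hJ; apply: JD; [apply: hx | apply: hy].
by have [[_ _ JM] _] := hJ; apply: JM; apply: hx.
Qed.

Lemma sub_ideal_gen S : S `<=` ideal_gen S.
Proof. exact: sub_smallest. Qed.

Lemma ideal_gen_min S J : ideal J -> S `<=` J -> ideal_gen S `<=` J.
Proof. by move=> iJ SJ x; apply; split. Qed.

Lemma idealT : ideal setT. Proof. by []. Qed.

Lemma ideal_expP I n : ideal (ideal_exp I n).
Proof. by case: n => [|n]; [exact: idealT | exact: ideal_genP]. Qed.

Lemma ideal_sum I (T : Type) (r : seq T) (P : pred T) (F : T -> A) : ideal I ->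
  (forall i, P i -> I (F i)) -> I (\sum_(i <- r | P i) F i).
Proof. by move=> [I0 ID _] h; apply: big_ind. Qed.

Lemma ideal_mulr I a x : ideal I -> I x -> I (x * a).
Proof. by move=> [_ _ IM] Ix; rewrite mulrC; apply: IM. Qed.

Lemma ideal_opp I x : ideal I -> I x -> I (- x).
Proof. by move=> [_ _ IM] Ix; rewrite -mulN1r; apply: IM. Qed.

Lemma ideal_expD I n p x y :
  ideal_exp I n x -> ideal_exp I p y -> ideal_exp I (n + p) (x * y).
Proof.
move=> + hy; elim: n x => [|n IH] x hx.
  by have [_ _] := ideal_expP I (0 + p); apply.
pose J := [set z | ideal_exp I (n.+1 + p) (z * y)].
have [e0 eD eM] := ideal_expP I (n.+1 + p).
suff: J x by []; apply: ideal_gen_min hx.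
  split; rewrite /J /=; first by rewrite mul0r.
    by move=> u v hu hv; rewrite mulrDl; apply: eD.
  by move=> u v hv; rewrite -mulrA; apply: eM.
move=> _ [u hu [v hv <-]]; rewrite /J /= -mulrA.
by apply: sub_ideal_gen; exists u => //; exists (v * y) => //; apply: IH.
Qed.

Lemma ideal_exp_le I n p x : (n <= p)%N -> ideal_exp I p x -> ideal_exp I n x.
Proof.
elim: n p x => [//|n IH] [//|p] x np; apply: ideal_gen_min.
  exact: ideal_genP.
move=> _ [u hu [v hv <-]]; apply: sub_ideal_gen.
by exists u => //; exists v => //; exact: IH hv.
Qed.

Lemma ideal_exp1 I x : I x -> ideal_exp I 1 x.
Proof. by move=> Ix; apply: sub_ideal_gen; exists x => //; exists 1; rewrite ?mulr1. Qed.

Definition graded_poly I n (p : {poly A}) := forall i, ideal_exp I (n - i) p`_i.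

Lemma graded_polyM I n m p q : graded_poly I n p -> graded_poly I m q ->
  graded_poly I (n + m) (p * q).
Proof.
move=> hp hq i; rewrite coefM; apply: ideal_sum => [|j _]; first exact: ideal_expP.
apply: (@ideal_exp_le _ _ (n - j + (m - (i - j)))); last exact: ideal_expD.
by have := ltn_ord j; lia.
Qed.

Lemma graded_poly_prod I (T : Type) (r : seq T) (F : T -> {poly A}) :
  (forall i, graded_poly I 1 (F i)) ->
  graded_poly I (size r) (\prod_(i <- r) F i).
Proof.
move=> hF; elim: r => [|a r IH] /=; first by rewrite big_nil.
by rewrite big_cons -add1n; apply: graded_polyM.
Qed.

Lemma graded_char_poly I n (M : 'M[A]_n) : ideal I -> (forall i j, I (M i j)) ->
  graded_poly I n (char_poly M).
Proof.
move=> iI hM; rewrite /char_poly /determinant => i.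
rewrite coef_sum; apply: ideal_sum => [|s _]; first exact: ideal_expP.
set p := \prod_i0 _; suff hp : graded_poly I n p.
  rewrite mulr_sign; case: ifP => _; rewrite ?coefN //.
  by apply: ideal_opp; [exact: ideal_expP | exact: hp].
rewrite /p -big_enum -[n in graded_poly _ n _]size_enum_ord.
apply: graded_poly_prod => j [|m]; last by rewrite subSS sub0n.
apply: ideal_exp1; rewrite !mxE coefB coefMn coefX mul0rn sub0r coefC /=.
by apply: ideal_opp.
Qed.

Lemma determinant_trick I n (v : 'I_n -> A) (M : 'M[A]_n) f :
  ideal I -> (forall i j, I (M i j)) ->
  (forall i, f * v i = \sum_j M i j * v j) ->
  (exists i, forall x, x * v i = 0 -> x = 0) ->
  integral_closure I f.
Proof.
move=> iI hM hv [i0 reg]; pose N := f%:M - M; pose V := \col_i v i.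
have NV : N *m V = 0.
  apply/matrixP => i j; rewrite mulmxBl mul_scalar_mx !mxE hv.
  by apply/eqP; rewrite subr_eq0; apply/eqP/eq_bigr => l _; rewrite !mxE.
have detN : \det N = 0.
  apply: reg; have := congr1 (fun X : 'cV_n => (\adj N *m X) i0 0) NV.
  by rewrite mulmxA mul_adj_mx mul_scalar_mx mulmx0 !mxE.
have : (char_poly M).[f] = 0.
  rewrite -detN -horner_evalE /char_poly -det_map_mx; congr (\det _).
  apply/matrixP => i j; rewrite !mxE rmorphB rmorphMn /= !horner_evalE.
  by rewrite hornerX hornerC.
rewrite horner_coef size_char_poly big_ord_recr /=.
have -> : (char_poly M)`_n = 1.
  by have /monicP := char_poly_monic M; rewrite /lead_coef size_char_poly.
rewrite mul1r addrC => h.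
exists n, (fun i => (char_poly M)`_(n - i)); split.
- by case: n i0 {v M f hM hv reg N V NV detN h} => [[]|].
- move=> i /andP[i0' iN]; have := graded_char_poly iI hM (n - i)%N.
  by rewrite subKn.
apply: etrans h; congr (_ + _); rewrite big_add1 /= big_mkord [RHS](reindex_inj rev_ord_inj).
by apply: eq_bigr.
Qed.

Lemma integral_closure0 I : ideal I -> integral_closure I 0.
Proof.
move=> iI; exists 1%N, (fun=> 0); split=> // [i _|].
  by have [] := ideal_expP I i.
by rewrite expr1 add0r big1 // => i _; rewrite mul0r.
Qed.

End Ideals.
Section MonomialIdeals.
Variables (k : fieldType) (d : nat) (A : coef_ring k d).
Local Notation E := 'X_{1..d}.
Local Notation coef := (@cr_coef k d A).
Local Notation mon := (@cr_mon k d A).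
Implicit Types (f g h : A) (D F : set E) (m u v : E) (I J : set A).

Definition mon_ideal D : set A := ideal_gen [set mon m | m in D].

Definition monomial_ideal I : Prop := exists D, I = mon_ideal D.

Definition ic_mon I : Prop :=
  [/\ monomial_ideal I, exists f, I f /\ f != 0 & integral_closure I = I].

Definition supp f : set E := [set m | coef f m != 0].

Lemma coef0 m : coef 0 m = 0.
Proof. by apply: (@addrI _ (coef 0 m)); rewrite -cr_coefD !addr0. Qed.

Lemma coef_sum (T : Type) (r : seq T) (P : pred T) (F : T -> A) m :
  coef (\sum_(i <- r | P i) F i) m = \sum_(i <- r | P i) coef (F i) m.
Proof.
by apply: (big_morph (fun f => coef f m)) => [f g|]; rewrite ?cr_coefD ?coef0.
Qed.

Lemma coefM_supp f g m : coef (f * g) m != 0 ->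
  exists u v, [/\ coef f u != 0, coef g v != 0 & m = (u + v)%MM].
Proof.
apply: contra_neqP => hn; rewrite cr_coefM /cauchy big1 // => -[u v] /= /eqP e.
have [u0|u0] := eqVneq (coef f u) 0; first by rewrite u0 mul0r.
have [v0|v0] := eqVneq (coef g v) 0; first by rewrite v0 mulr0.
by case: hn; exists u, v.
Qed.

Lemma coefM_uniq f g u v :
  (forall u' v', (u + v = u' + v')%MM -> coef f u' != 0 -> coef g v' != 0 ->
     u' = u) ->
  coef (f * g) (u + v)%MM = coef f u * coef g v.
Proof.
move=> huv; rewrite cr_coefM /cauchy.
have hu : (mdeg u < (mdeg (u + v)%MM).+1)%N by rewrite ltnS mdegD leq_addr.
have hv : (mdeg v < (mdeg (u + v)%MM).+1)%N by rewrite ltnS mdegD leq_addl.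
rewrite (bigD1 (BMultinom hu, BMultinom hv)) //= big1 ?addr0 //.
move=> [u' v'] /= /andP[/eqP e ne].
have [u0|u0] := eqVneq (coef f u') 0; first by rewrite u0 mul0r.
have [v0|v0] := eqVneq (coef g v') 0; first by rewrite v0 mulr0.
have eu := huv _ _ e u0 v0; case/eqP: ne.
congr (_, _); apply: val_inj => //=.
by rewrite eu in e; move/addmI: e.
Qed.

Lemma coefMmon f u m : coef (f * mon u) (m + u)%MM = coef f m.
Proof.
rewrite coefM_uniq; first by rewrite cr_coef_mon eqxx mulr1.
move=> u' v' e _; rewrite cr_coef_mon.
case: (u =P v') => [uv _|]; last by rewrite eqxx.
by rewrite -uv in e; move/addIm: e.
Qed.

Lemma coefMmon0 f u m : ~~ (u <= m)%MM -> coef (f * mon u) m = 0.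
Proof.
apply: contraNeq => /coefM_supp[a [b [_ + ->]]].
rewrite cr_coef_mon; case: (u =P b) => [-> _|]; last by rewrite eqxx.
exact: lem_addl.
Qed.

Lemma mon_reg u f : f * mon u = 0 -> f = 0.
Proof.
by move=> h; apply: cr_coef_inj => m; rewrite -(coefMmon f u) h !coef0.
Qed.

Lemma mon_neq0 u : mon u != 0.
Proof.
apply/eqP => /(congr1 (fun f => coef f u)) /eqP.
by rewrite cr_coef_mon coef0 eqxx oner_eq0.
Qed.

Lemma monM u v : mon u * mon v = mon (u + v)%MM.
Proof.
apply: cr_coef_inj => m; rewrite cr_coef_mon.
have [/le_exists[w ->]|vm] := boolP (v <= m)%MM.
  by rewrite [(v + w)%MM]addmC coefMmon cr_coef_mon eqm_add2r.
rewrite coefMmon0 //; case: eqP => // e; case/negP: vm.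
by rewrite -e; exact: lem_addl.
Qed.

Lemma split_supp D (l : seq E) h :
  (forall m, supp h m -> exists w e, [/\ w \in l, up D e & m = (e + w)%MM]) ->
  exists a : 'I_(size l) -> A, (forall i, supp (a i) `<=` up D) /\
    h = \sum_i a i * mon (nth 0%MM l i).
Proof.
move=> hl; pose w (i : 'I_(size l)) := nth 0%MM l i.
pose ch m : option 'I_(size l) := [pick i | (w i <= m)%MM && `[< up D (m - w i)%MM >]].
have hch m i : ch m = Some i -> (w i <= m)%MM /\ up D (m - w i)%MM.
  by rewrite /ch; case: pickP => // j /andP[? /asboolP ?] [<-].
have ex i : exists g, forall m,
    coef g m = if ch (m + w i)%MM == Some i then coef h (m + w i)%MM else 0.
  have [g hg] := cr_restrict (fun m => ch m == Some i) h.
  by have [g' hg'] := cr_shift (w i) g; exists g' => m; rewrite hg' hg.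
pose a i := projT1 (cid (ex i)).
have aE i m : coef (a i) m = if ch (m + w i)%MM == Some i then coef h (m + w i)%MM else 0.
  exact: (projT2 (cid (ex i))).
exists a; split.
  move=> i m; rewrite /supp /= aE; case: ifP => [/eqP/hch[_]|]; last by rewrite eqxx.
  by rewrite addmK.
apply: cr_coef_inj => m; rewrite coef_sum.
have coefa i : coef (a i * mon (w i)) m = if ch m == Some i then coef h m else 0.
  have [/submK e|wm] := boolP (w i <= m)%MM.
    by rewrite -{1}e coefMmon aE e.
  rewrite coefMmon0 //; case: eqP => // /hch[wm' _].
  by rewrite wm' in wm.
rewrite (eq_bigr _ (fun i _ => coefa i)).
have [h0|h0] := eqVneq (coef h m) 0.
  by rewrite h0 big1 // => i _; case: ifP.
case E: (ch m) => [i|].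
  rewrite (bigD1 i) //= eqxx big1 ?addr0 // => j ji.
  by case: eqP => // -[ij]; rewrite ij eqxx in ji.
have [v [e [vl De me]]] := hl m h0.
move: E; rewrite /ch; case: pickP => // /(_ (Ordinal (etrans (index_mem v l) vl))).
by rewrite /w /= nth_index // me addmK lem_addl (asboolT De).
Qed.

Lemma supp_ideal D : up D = D -> ideal [set f | supp f `<=` D].
Proof.
move=> upD; split.
- by move=> m; rewrite /supp /= coef0 eqxx.
- move=> f g hf hg m; rewrite /supp /= cr_coefD => h.
  have [f0|/hf //] := eqVneq (coef f m) 0.
  by apply: hg; rewrite /supp /=; rewrite f0 add0r in h.
- move=> a f hf m /coefM_supp[u [v [_ /hf hv ->]]].
  by rewrite -upD addmC; apply/upP; exists v, u.
Qed.

Lemma up_up D : up (up D) = up D.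
Proof.
apply/seteqP; split=> m; last by move=> h; exists m => //; exact: lepm_refl.
by move=> [e [e' De' e'e] em]; exists e' => //; exact: lepm_trans em.
Qed.

Lemma sub_up D : D `<=` up D.
Proof. by move=> m Dm; exists m => //; exact: lepm_refl. Qed.

Lemma supp_mon u : supp (mon u) = [set u].
Proof.
apply/seteqP; split=> m; rewrite /supp /= cr_coef_mon.
  by case: (u =P m) => [->|]; rewrite ?eqxx.
by move=> ->; rewrite eqxx oner_eq0.
Qed.

Lemma mon_idealP D f : mon_ideal D f <-> supp f `<=` up D.
Proof.
split=> [h|h].
  pose J := [set g | supp g `<=` up D].
  suff : J f by []; apply: ideal_gen_min h; first exact/supp_ideal/up_up.
  by move=> _ [m Dm <-]; rewrite /J /= supp_mon => _ ->; exact: sub_up.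
have [l [lD Dl]] := dickson D.
have [|a [_ ->]] := @split_supp setT l f.
  move=> m /h [e /Dl[g gl ge] em]; exists g, (m - g)%MM.
  by rewrite submK ?(lepm_trans ge) //; split=> //; exact: sub_up.
have iD := ideal_genP [set mon m | m in D].
apply: ideal_sum => // i _; have [_ _ iM] := iD; apply: iM.
by apply: sub_ideal_gen; exists (nth 0%MM l i) => //; apply: lD; exact: mem_nth.
Qed.

Lemma mon_ideal_mon D u : mon_ideal D (mon u) <-> up D u.
Proof.
by rewrite mon_idealP supp_mon; split=> [h|h _ ->] //; apply: h.
Qed.

Lemma mon_idealE D : mon_ideal D = [set f | supp f `<=` up D].
Proof. by apply/seteqP; split=> f /mon_idealP. Qed.

Lemma mon_ideal_up D : mon_ideal (up D) = mon_ideal D.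
Proof. by rewrite !mon_idealE up_up. Qed.

Lemma nfold_upE D n : nfold (up D) n = nfold D n.
Proof.
apply/seteqP; split; last exact/nfold_sub/sub_up.
elim: n => [//|n IH] _ [e [m' [/upP[g [v [Dg ->]]] /IH h ->]]].
exists g, (v + m')%MM; rewrite addmA; split=> //.
by rewrite addmC; exact: nfold_up.
Qed.

Lemma supp_exp D n f : ideal_exp (mon_ideal D) n f -> supp f `<=` nfold D n.
Proof.
have upn p : up (nfold D p) = nfold D p.
  apply/seteqP; split=> m; last exact: sub_up.
  by move=> /upP[e [v [h ->]]]; exact: nfold_up.
elim: n f => [//|n IH] f hf.
pose J := [set g | supp g `<=` nfold D n.+1].
suff : J f by []; apply: ideal_gen_min hf; first exact/supp_ideal/upn.
move=> _ [a /mon_idealP ha [b /IH hb <-]] _ /coefM_supp[u [v [/ha hu /hb hv ->]]].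
by rewrite -nfold_upE; exists u, v; rewrite nfold_upE.
Qed.

Lemma supp_expr f F n : supp f `<=` F -> supp (f ^+ n) `<=` nfold F n.
Proof.
move=> hf; elim: n => [//|n IH] m; rewrite exprS.
by move=> /coefM_supp[u [v [/hf hu /IH hv ->]]]; exists u, v.
Qed.

Lemma supp_closure D f :
  integral_closure (mon_ideal D) f -> supp f `<=` sat D.
Proof.
move=> [n [a [n0 ha e]]].
pose F := D `|` supp f.
have [l [lF Fl]] := dickson (supp f).
have [||h|[al [D' [Fal nDal nD'al DD' FD']]]] := @exists_extremal _ D F l.
- by move=> m /lF; right.
- move=> m [Dm|/Fl[g gl gm]]; first by apply: sub_sat; left.
  by rewrite -up_sat; exists g => //; apply: sub_sat; right.
- by move=> m fm; apply: h; right.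
have fal : coef f al != 0 by case: Fal.
have powE p : coef (f ^+ p) (al *+ p)%MM = coef f al ^+ p.
  elim: p => [|p IH]; first by rewrite expr0 cr_coef1 mulm0n eqxx.
  rewrite !exprS mulmS coefM_uniq ?IH // => u v e' fu fv.
  apply: (@extremal _ al D' p u v) => //; first by apply: FD'; right.
    have {}fv : nfold (supp f) p v by apply: (supp_expr (F := supp f) _ fv).
    by apply: nfold_sub fv => m fm; apply: FD'; right.
  by rewrite -e' mulmS.
have := congr1 (fun g => coef g (al *+ n)%MM) e; rewrite /= cr_coefD powE coef_sum coef0.
rewrite big1_seq ?addr0.
  by move=> /eqP; rewrite expf_eq0 (negbTE fal) andbF.
move=> i /andP[_]; rewrite mem_index_iota => /andP[i0 iN].
apply/eqP/contraT => /coefM_supp[u [v [hu hv uv]]].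
case: i i0 iN hu hv => // i _; rewrite ltnS => iN hu hv.
have hai : ideal_exp (mon_ideal D) i.+1 (a i.+1) by apply: ha.
have [g [w [Dg hw eu]]] : nfold D i.+1 u by apply: (supp_exp hai hu).
case: nDal; suff <- : g = al by [].
have DFs : D `<=` sat (al |` D') by move=> m Dm; apply: FD'; left.
have hv' : nfold (supp f) (n - i.+1) v by apply: (supp_expr (F := supp f) _ hv).
apply: (@extremal _ al D' n.-1 g (w + v)%MM) => //; first exact: DFs.
  have -> : (n.-1 = i + (n - i.+1))%N by lia.
  apply: nfoldD; first exact: nfold_sub hw.
  by apply: nfold_sub hv' => m fm; apply: FD'; right.
by rewrite prednK // addmA -eu.
Qed.

Lemma closure_supp D f :
  supp f `<=` sat D -> integral_closure (mon_ideal D) f.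
Proof.
move=> hf; have iD := ideal_genP [set mon m | m in D].
have [->|f0] := eqVneq f 0; first exact: integral_closure0.
have [al fal] : exists m, supp f m.
  apply: contrapT => h; case/eqP: f0; apply: cr_coef_inj => m.
  by rewrite coef0; apply/eqP/negP => /negP fm; apply: h; exists m.
have [n hn] := sat_reduction D.
have [l [lD Dl]] := dickson (nfold (sat D) n).
have l0 : (0 < size l)%N.
  have /Dl[g] : nfold (sat D) n (al *+ n)%MM.
    rewrite -[n in nfold _ n]mul1n; apply: nfold_mul.
    by exists al, 0%MM; rewrite addm0; split=> //; exact: hf.
  by case: (l).
have split_f (i : 'I_(size l)) : exists a : 'I_(size l) -> A,
    (forall j, supp (a j) `<=` up D) /\
    f * mon (nth 0%MM l i) = \sum_j a j * mon (nth 0%MM l j).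
  apply: split_supp => m /coefM_supp[u [v [/hf hu]]].
  rewrite cr_coef_mon; case: (_ =P v) => [<- _|]; last by rewrite eqxx.
  move=> em; have [|e [m' [De hm' em']]] := hn m.
    by exists u, (nth 0%MM l i); split=> //; apply/lD/mem_nth.
  have /upP[g [w [gl em'']]] := Dl _ hm'.
  exists g, (e + w)%MM; split=> //; first by apply/upP; exists e, w.
  by rewrite em' em'' addmA; apply/mnmP => j; rewrite !mnmDE; lia.
pose M := \matrix_(i, j) projT1 (cid (split_f i)) j.
have MP i : (forall j, supp (M i j) `<=` up D) /\
    f * mon (nth 0%MM l i) = \sum_j M i j * mon (nth 0%MM l j).
  have [h1 h2] := projT2 (cid (split_f i)); split=> [j|]; first by rewrite mxE.
  by rewrite h2; apply: eq_bigr => j _; rewrite mxE.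
apply: (@determinant_trick A _ _ (fun i : 'I_(size l) => mon (nth 0%MM l i)) M) => //.
- by move=> i j; apply/mon_idealP; exact: (MP i).1.
- by move=> i; exact: (MP i).2.
- by exists (Ordinal l0) => x; exact: mon_reg.
Qed.

Lemma closure_mon_ideal D :
  integral_closure (mon_ideal D) = mon_ideal (sat D).
Proof.
apply/seteqP; split=> f.
  by move=> /supp_closure h; apply/mon_idealP; rewrite up_sat.
by move=> /mon_idealP; rewrite up_sat; exact: closure_supp.
Qed.

Lemma mul_mon_ideal D F :
  ideal_mul (mon_ideal D) (mon_ideal F) = mon_ideal (exp_add D F).
Proof.
apply/seteqP; split.
  apply: ideal_gen_min; first exact: ideal_genP.
  move=> _ [f /mon_idealP hf [g /mon_idealP hg <-]]; apply/mon_idealP.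
  move=> _ /coefM_supp[u [v [/hf/upP[a [b [Da ->]]] /hg/upP[c [e [Fc ->]]] ->]]].
  apply/upP; exists (a + c)%MM, (b + e)%MM; split; first by exists a, c.
  by apply/mnmP => i; rewrite !mnmDE; lia.
apply: ideal_gen_min; first exact: ideal_genP.
move=> _ [_ [u [v [Du Fv ->]]] <-]; apply: sub_ideal_gen.
exists (mon u); first by apply: sub_ideal_gen; exists u.
by exists (mon v); [apply: sub_ideal_gen; exists v | rewrite monM].
Qed.

Lemma mul_mon_mon_ideal u D :
  [set mon u * f | f in mon_ideal D] = mon_ideal (shift_exp u D).
Proof.
apply/seteqP; split.
  move=> _ [f /mon_idealP hf <-]; apply/mon_idealP => _ /coefM_supp[v [w [uv wf ->]]].
  move: uv; rewrite cr_coef_mon; case: (u =P v) => [<- _|]; last by rewrite eqxx.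
  have /upP[e [x [De ->]]] := hf _ wf; apply/upP; exists (u + e)%MM, x.
  by rewrite addmA; split=> //; exists e.
move=> f /mon_idealP hf; have [g hg] := cr_shift u f.
exists g.
  apply/mon_idealP => m gm; have /hf/upP[_ [v [[e De ->]]]] : supp f (m + u)%MM.
    by rewrite /supp /= -hg.
  rewrite addmC -addmA => /addmI ->; apply/upP; exists e, v; by split.
apply: cr_coef_inj => m; rewrite mulrC.
have [/submK e|um] := boolP (u <= m)%MM; first by rewrite -e coefMmon hg.
rewrite coefMmon0 //; apply/eqP; rewrite eq_sym; apply: contraNT um => /hf.
move=> /upP[_ [v [[e De ->] ->]]]; rewrite -addmA; exact: lem_addr.
Qed.

Definition exps I : set E := [set m | I (mon m)].

Lemma exps_mon_ideal D : exps (mon_ideal D) = up D.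
Proof. by apply/seteqP; split=> m /mon_ideal_mon. Qed.

Lemma ic_mon_mon_ideal D m : sat D = D -> D m -> ic_mon (mon_ideal D).
Proof.
move=> sD Dm; split; first by exists D.
  by exists (mon m); split; [apply: sub_ideal_gen; exists m | exact: mon_neq0].
by rewrite closure_mon_ideal sD.
Qed.

Lemma ic_monP I : ic_mon I ->
  [/\ I = mon_ideal (exps I), sat (exps I) = exps I & exists m, exps I m].
Proof.
move=> [[D ->] [f [/mon_idealP fD f0]] cD].
have e : up D = sat D.
  by rewrite -exps_mon_ideal -cD closure_mon_ideal exps_mon_ideal up_sat.
rewrite exps_mon_ideal mon_ideal_up e sat_sat; split=> //.
apply: contrapT => h; case/eqP: f0; apply: cr_coef_inj => m.
by rewrite coef0; apply/eqP/negP => /negP /fD fm; apply: h; exists m; rewrite -e.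
Qed.

Record ic_ideal := IcIdeal { ic_set :> set A; _ : `[< ic_mon ic_set >] }.

HB.instance Definition _ := [isSub for ic_set].
HB.instance Definition _ := [Choice of ic_ideal by <:].

Lemma ic_idealP (I : ic_ideal) : ic_mon I.
Proof. by case: I => I /= /asboolP. Qed.

Lemma ic_exps_inj (I J : ic_ideal) : exps I = exps J -> I = J.
Proof.
move=> e; apply: val_inj => /=.
have [-> _ _] := ic_monP (ic_idealP I); have [-> _ _] := ic_monP (ic_idealP J).
by rewrite e.
Qed.

Lemma ic_mulE (I J : ic_ideal) : integral_closure (ideal_mul I J) =
  mon_ideal (sat (exp_add (exps I) (exps J))).
Proof.
have [eI _ _] := ic_monP (ic_idealP I).
have [eJ _ _] := ic_monP (ic_idealP J).
by rewrite -closure_mon_ideal -mul_mon_ideal -eI -eJ.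
Qed.

Lemma ic_mul_subproof (I J : ic_ideal) :
  ic_mon (integral_closure (ideal_mul I J)).
Proof.
have [_ _ [u Iu]] := ic_monP (ic_idealP I).
have [_ _ [v Jv]] := ic_monP (ic_idealP J).
rewrite ic_mulE; apply: (@ic_mon_mon_ideal _ (u + v)%MM); first exact: sat_sat.
by apply: sub_sat; exists u, v.
Qed.

Lemma ic_one_subproof : ic_mon setT.
Proof.
have -> : setT = mon_ideal [set: E].
  by apply/seteqP; split=> // f _; apply/mon_idealP => m _; exact: sub_up.
by apply: (@ic_mon_mon_ideal _ 0%MM) => //; apply/seteqP; split=> // m _; exact: sub_sat.
Qed.

Definition ic_one : ic_ideal := IcIdeal (asboolT ic_one_subproof).
Definition ic_mul (I J : ic_ideal) : ic_ideal :=
  IcIdeal (asboolT (ic_mul_subproof I J)).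

Lemma exps_ic_mul (I J : ic_ideal) :
  exps (ic_mul I J) = sat (exp_add (exps I) (exps J)).
Proof. by rewrite /= ic_mulE exps_mon_ideal up_sat. Qed.

Lemma ic_mulA : associative ic_mul.
Proof.
move=> I J K; apply: ic_exps_inj; rewrite !exps_ic_mul.
by rewrite sat_exp_add_satr sat_exp_add_satl exp_addA.
Qed.

Lemma ic_mulC : commutative ic_mul.
Proof. by move=> I J; apply: ic_exps_inj; rewrite !exps_ic_mul exp_addC. Qed.

Lemma ic_mul1 : left_id ic_one ic_mul.
Proof.
move=> I; apply: ic_exps_inj; rewrite exps_ic_mul.
have [_ sI _] := ic_monP (ic_idealP I); rewrite -[RHS]sI; congr sat.
apply/seteqP; split=> m; last by move=> Im; exists 0%MM, m; rewrite add0m.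
by move=> [u [v [_ Iv ->]]]; rewrite -sI -up_sat sI addmC; apply/upP; exists v, u.
Qed.

(* The monoid law I * J is written additively: I + J. *)
HB.instance Definition _ := GRing.isNmodule.Build ic_ideal ic_mulA ic_mulC ic_mul1.

Definition ic_sim (I J : ic_ideal) : bool :=
  `[< exists u v, [set mon u * f | f in I] = [set mon v * f | f in J] >].

Lemma ic_simP (I J : ic_ideal) : reflect
  (exists u v, shift_exp u (exps I) = shift_exp v (exps J)) (ic_sim I J).
Proof.
have [eI sI _] := ic_monP (ic_idealP I); have [eJ sJ _] := ic_monP (ic_idealP J).
have ups u D : sat D = D -> up (shift_exp u D) = shift_exp u D.
  by move=> sD; rewrite -{1}sD -sat_shift up_sat sat_shift sD.
apply: (iffP (asboolP _)) => -[u [v e]]; exists u, v.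
  move: e; rewrite {1}eI {1}eJ !mul_mon_mon_ideal => /(congr1 exps).
  by rewrite !exps_mon_ideal !ups.
by rewrite eI eJ !mul_mon_mon_ideal e.
Qed.

Lemma ic_sim_refl : reflexive ic_sim.
Proof. by move=> I; apply/ic_simP; exists 0%MM, 0%MM. Qed.

Lemma ic_sim_sym : ssrbool.symmetric ic_sim.
Proof. by move=> I J; apply/ic_simP/ic_simP => -[u [v e]]; exists v, u. Qed.

Lemma ic_sim_trans : transitive ic_sim.
Proof.
move=> J I K /ic_simP[u [v e]] /ic_simP[u' [v' e']]; apply/ic_simP.
exists (u' + u)%MM, (v + v')%MM.
by rewrite -shift_expD e shift_expD addmC -shift_expD e' shift_expD.
Qed.

Canonical ic_sim_equiv := EquivRel ic_sim ic_sim_refl ic_sim_sym ic_sim_trans.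
Definition ic_quot := {eq_quot ic_sim_equiv}.
HB.instance Definition _ := Choice.on ic_quot.
HB.instance Definition _ := EqQuotient.on ic_quot.

Definition ic_quot_zero : ic_quot := \pi_ic_quot 0.
Definition ic_quot_add (x y : ic_quot) : ic_quot := \pi_ic_quot (repr x + repr y).

Lemma ic_quotW (P : ic_quot -> Prop) :
  (forall I : ic_ideal, P (\pi_ic_quot I)) -> forall x, P x.
Proof. by move=> h x; rewrite -[x]reprK. Qed.

Lemma ic_sim_mul (I J K : ic_ideal) : ic_sim I J -> ic_sim (I + K) (J + K).
Proof.
move=> /ic_simP[u [v e]]; apply/ic_simP; exists u, v.
by rewrite !exps_ic_mul -!sat_shift -!exp_add_shift e.
Qed.

Lemma ic_quot_add_pi (I J : ic_ideal) :
  ic_quot_add (\pi_ic_quot I) (\pi_ic_quot J) = \pi_ic_quot (I + J).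
Proof.
have sim (K : ic_ideal) : ic_sim (repr (\pi_ic_quot K)) K.
  by apply/eqmodP; rewrite reprK.
apply/eqmodP; apply: (@ic_sim_trans (I + repr (\pi_ic_quot J))).
  exact/ic_sim_mul/sim.
by rewrite ![I + _]addrC; exact/ic_sim_mul/sim.
Qed.

Lemma ic_quot_addA : associative ic_quot_add.
Proof.
elim/ic_quotW=> I; elim/ic_quotW=> J; elim/ic_quotW=> K.
by rewrite !ic_quot_add_pi addrA.
Qed.

Lemma ic_quot_addC : commutative ic_quot_add.
Proof.
by elim/ic_quotW=> I; elim/ic_quotW=> J; rewrite !ic_quot_add_pi addrC.
Qed.

Lemma ic_quot_add0 : left_id ic_quot_zero ic_quot_add.
Proof. by elim/ic_quotW=> I; rewrite /ic_quot_zero ic_quot_add_pi add0r. Qed.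

HB.instance Definition _ :=
  GRing.isNmodule.Build ic_quot ic_quot_addA ic_quot_addC ic_quot_add0.

Definition ic_group := grothendieck ic_quot.

Definition ic_class (I : ic_ideal) : ic_group := gro_class (\pi_ic_quot I).

End MonomialIdeals.

Arguments orthant {R d}.
Arguments nat_vec R {d} m.
Arguments mon_ideal {k d} A D.

(* Main.v *)
(* Write a polytope P with vertices in N^d as the convex hull of finitely many *)
(* exponents l. The exponents in P + R_+^d are those of the integral closure  *)
(* of (x^u | u in l): real barycentric weights can be replaced by rational    *)
(* ones by simultaneous Diophantine approximation. Hence Minkowski sums go to *)
(* I * J and integer translations to multiplication by monomials, so that phi *)
(* is well defined and additive. It is onto because an integrally closed      *)
(* monomial ideal is the closure of finitely many monomials (Dickson), hence  *)
(* comes from the convex hull of their exponents.                             *)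
From HB Require Import structures.
Require Import Defs.
From mathcomp Require Import all_boot all_order all_algebra.
From mathcomp Require Import boolp classical_sets reals mpoly.
From mathcomp Require Import archimedean zify ring lra.
Set Implicit Arguments.
Unset Strict Implicit.
Unset Printing Implicit Defensive.
Import Order.TTheory GRing.Theory Num.Theory.
Local Open Scope ring_scope.
Local Open Scope classical_set_scope.
Local Open Scope quotient_scope.

(** The bridge between the two sides is the Newton polyhedron. For a finite list [l] of exponents,
    x^m is integral over (x^u | u in l) iff some multiple n m, n > 0, dominates a sum of n members
    of [l]; dividing by n, this says that m lies in the hull of [l] plus the orthant
    ([orthant_exps_conv_hull]). Division is [nfold_mean]; the converse, clearing denominators, is
    [sat_of_weights]. A polytope is the hull of its vertices ([conv_hull_vertices]), so one with
    vertices in N^d is given by such a list. Hence Minkowski sums become products I * J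
    ([orthant_expsD]) and natural translations become multiplication by monomials
    ([orthant_exps_shift]). The class of the ideal is then independent of the translate, additive,
    and zero on points ([represents_uniq], [representsD], [represents_point]), which is what the
    universal properties of both groups require. Every ideal class is reached by
    [polytope_of_ideal], and these classes generate the target. *)

(** * Rational approximation of barycentric weights *)

(** Dirichlet's pigeonhole: the unit cube is cut into boxes of side 1/(M+1) < eps. Among more
    multiples of [w] than boxes, two have fractional parts in the same box; q is the difference of
    their indices. *)
Lemma dirichlet_approx (R : realType) n (w : 'I_n -> R) (eps : R) : 0 < eps ->
  exists (q : nat) (p : 'I_n -> int), (0 < q)%N /\
    forall i, `|q%:R * w i - (p i)%:~R| < eps.
Proof.
move=> eps0; pose M := Num.truncn eps^-1.
have Me : M.+1%:R^-1 < eps.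
  rewrite invf_plt ?posrE ?ltr0n //.
  by have /andP[] := truncn_itv (ltW (etrans (invr_gt0 eps) eps0)).
pose fr (j : nat) i : R := j%:R * w i - (Num.floor (j%:R * w i))%:~R.
have fr_itv j i : 0 <= fr j i < 1.
  by have := floor_itv (j%:R * w i); rewrite /fr intrD; lra.
have M0 : (0 : R) < M.+1%:R by rewrite ltr0n.
pose b j i := Num.truncn (M.+1%:R * fr j i).
have bM j i : (b j i < M.+1)%N.
  have /andP[f0 f1] := fr_itv j i.
  rewrite /b truncn_lt_nat; last by rewrite mulr_ge0 // ltW.
  by rewrite -[ltRHS]mulr1 ltr_pM2l.
have [K cK] : exists K, #|{ffun 'I_n -> 'I_M.+1}| = K by eexists.
pose box := fun j : 'I_K.+1 => [ffun i => Ordinal (bM j i)].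
have /injectivePn[j [j' jj' ejj']] : ~~ injectiveb box.
  by apply/negP => /injectiveP/leq_card; rewrite card_ord cK ltnn.
have close i : `|fr j i - fr j' i| < M.+1%:R^-1.
  have /ffunP/(_ i) := ejj'; rewrite !ffunE => /(congr1 val) /= e.
  have /andP[f0 _] := fr_itv j i; have /andP[f0' _] := fr_itv j' i.
  rewrite -div1r ltr_pdivlMr // -[M.+1%:R in ltLHS](gtr0_norm M0) -normrM.
  have := truncn_itv (mulr_ge0 (ltW M0) f0).
  have := truncn_itv (mulr_ge0 (ltW M0) f0').
  rewrite -/(b _ _) -/(b _ _) e -[(b _ _).+1%:R]natr1 ltr_norml; lra.
wlog lt : j j' jj' {ejj'} close / (j < j')%N.
  move=> H; have [|lt|/val_inj e] := ltngtP j j'; first exact: H.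
    by apply: (H j' j) lt; [rewrite eq_sym | move=> i; rewrite distrC; exact: close].
  by rewrite e eqxx in jj'.
exists (j' - j)%N, (fun i => Num.floor (j'%:R * w i) - Num.floor (j%:R * w i)).
rewrite subn_gt0; split=> // i; rewrite distrC.
suff -> : (Num.floor (j'%:R * w i) - Num.floor (j%:R * w i))%:~R -
  (j' - j)%:R * w i = fr j i - fr j' i by exact: lt_trans Me.
rewrite natrB; last exact: ltnW.
by rewrite rmorphB /fr /=; ring.
Qed.

Lemma nfold_sum d (D : set 'X_{1..d}) (I : Type) (r : seq I) (n : I -> nat)
    (m : I -> 'X_{1..d}) :
  (forall i, D (m i)) ->
  nfold D (\sum_(i <- r) n i)%N (\sum_(i <- r) m i *+ n i)%MM.
Proof.
move=> mD; elim: r => [|i r IH]; first by rewrite !big_nil.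
rewrite !big_cons; apply: nfoldD => //.
rewrite -[X in nfold _ X]mul1n; apply: nfold_mul.
by rewrite nfold1; exists (m i) => //; exact: lepm_refl.
Qed.

(* Approximating the weights by fractions with a common denominator perturbs *)
(* an inequality between integers by less than 1, so it remains true.        *)
Lemma sat_of_weights (R : realType) d n (l : 'I_n -> 'X_{1..d}) (w : 'I_n -> R)
    (m : 'X_{1..d}) :
  (forall i, 0 <= w i) -> \sum_i w i = 1 ->
  (forall j, \sum_i w i * (l i j)%:R <= (m j)%:R) ->
  sat (range l) m.
Proof.
move=> w0 w1 wm.
pose c i j : R := (l i j)%:R - (m j)%:R.
(* Bounds the total size of each coefficient family used below: the constant 1, of total n, and each
   column of [c]. *)
pose B : R := n%:R + \sum_i \sum_j `|c i j|.
have B0 : 0 <= B by rewrite addr_ge0 // sumr_ge0 // => i _; apply: sumr_ge0.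
have [eps [eps0 eps1 epsB]] : exists eps : R, [/\ 0 < eps, eps <= 1 & eps * B < 1].
  exists (B + 1)^-1; have B1 : 0 < B + 1 by lra.
  by rewrite invr_gt0 invf_le1 // mulrC ltr_pdivrMr //; split=> //; lra.
have [q [p [q0 pq]]] := dirichlet_approx w eps0.
have q1 : (1 : R) <= q%:R by rewrite ler1n.
have p0 i : 0 <= p i.
  rewrite -ltzD1 -(ltr_int R) intrD.
  have := pq i; have : 0 <= q%:R * w i by rewrite mulr_ge0.
  by rewrite ltr_norml; lra.
have [k pk] : exists k : 'I_n -> nat, forall i, p i = (k i)%:Z.
  by exists (fun i => `|p i|%N) => i; rewrite gez0_abs.
have {p0}kq i : `|(k i)%:R - q%:R * w i| < eps.
  by rewrite distrC; have := pq i; rewrite pk pmulrn.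
have small (e : 'I_n -> R) : \sum_i `|e i| <= B ->
    `|\sum_i ((k i)%:R - q%:R * w i) * e i| < 1.
  move=> eB; apply: (@le_lt_trans _ _ (\sum_i eps * `|e i|)).
    apply: le_trans (ler_norm_sum _ _ _) _; apply: ler_sum => i _.
    by rewrite normrM ler_wpM2r // ltW.
  rewrite -mulr_sumr; nra.
(* The weights sum to 1, so the total of the [k i] differs from q >= 1 by less than 1. *)
have N0 : (0 < \sum_i k i)%N.
  rewrite -(ltr_nat R) natr_sum.
  have /small /= : \sum_(i < n) `|(1 : R)| <= B.
    rewrite normr1 sumr_const card_ord lerDl sumr_ge0 // => i _.
    exact: sumr_ge0.
  under eq_bigr do rewrite mulr1.
  rewrite big_split /= sumrN -mulr_sumr w1 mulr1 ltr_norml; lra.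
exists (\sum_i k i)%N; split=> //.
have le_m : (\sum_i l i *+ k i <= m *+ \sum_i k i)%MM.
  apply/mnm_lepP => j; rewrite mulmnE mnm_sumE.
  under eq_bigr do rewrite mulmnE.
  rewrite -ltnS -(ltr_nat R) -natr1 natrM !natr_sum mulr_sumr -subr_gt0.
  have /small /= : \sum_(i < n) `|c i j| <= B.
    rewrite -[leLHS]add0r lerD //; apply: ler_sum => i _.
    by rewrite (bigD1 j) //= lerDl sumr_ge0.
  have : q%:R * \sum_i w i * c i j <= 0.
    rewrite pmulr_rle0 ?ltr0n // /c; under eq_bigr do rewrite mulrBr.
    rewrite big_split /= sumrN -mulr_suml w1 mul1r subr_le0; exact: wm.
  under [\sum_(i < n) ((k i)%:R - _) * _]eq_bigr do rewrite mulrBl -mulrA.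
  rewrite big_split /= sumrN -mulr_sumr ltr_norml.
  under [\sum_(i < n) (k i)%:R * _]eq_bigr do rewrite mulrBr.
  under [\sum_(i < n) (_ * _)%:R]eq_bigr do rewrite natrM mulrC.
  under [\sum_(i < n) (m j)%:R * _]eq_bigr do rewrite mulrC.
  rewrite [\sum_(i < n) (_ - _)]big_split /= sumrN; lra.
have [v ->] := le_exists le_m; apply: nfold_up; apply: nfold_sum => i.
by exists i.
Qed.

(** * Convex hulls and vertices of polytopes *)

Section ConvexHulls.
Variables (R : realType) (d : nat).
Local Notation vec := 'rV[R]_d.
Implicit Types (S T C : set vec) (x y : vec).

Lemma conv_hull_id C : convex C -> conv_hull C = C.
Proof.
by move=> cC; apply/seteqP; split; [exact: conv_hull_min | exact: sub_conv_hull].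
Qed.

Lemma sub_conv_hull2 S T : S `<=` conv_hull T -> conv_hull S `<=` conv_hull T.
Proof. by apply: conv_hull_min; exact: convex_conv_hull. Qed.

Lemma convex_set1 x : convex [set x].
Proof. by move=> _ _ t -> -> _ /=; rewrite -scalerDl addrC subrK scale1r. Qed.

Lemma conv_hull0 : conv_hull set0 = set0 :> set vec.
Proof. exact: conv_hull_id. Qed.

Lemma convex_minkowski S T : convex S -> convex T -> convex (minkowski S T).
Proof.
move=> /conv_hull_id <- /conv_hull_id <-; rewrite conv_hull_minkowski.
exact: convex_conv_hull.
Qed.

Lemma convex_orthant : convex (@orthant R d).
Proof.
move=> x y t hx hy /andP[t0 t1] i; rewrite !mxE.
by rewrite addr_ge0 // mulr_ge0 ?subr_ge0 //.
Qed.

Lemma conv_hull_weights (I : finType) (p : I -> vec) x :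
  conv_hull (range p) x ->
  exists w : I -> R, [/\ forall i, 0 <= w i, \sum_i w i = 1 & x = \sum_i w i *: p i].
Proof.
pose C := [set x | exists w : I -> R,
  [/\ forall i, 0 <= w i, \sum_i w i = 1 & x = \sum_i w i *: p i]].
apply: (@conv_hull_min _ _ _ C).
  move=> _ _ t [w [w0 w1 ->]] [w' [w'0 w'1 ->]] /andP[t0 t1].
  exists (fun i => t * w i + (1 - t) * w' i); split=> [i||].
  - by rewrite addr_ge0 // mulr_ge0 // subr_ge0.
  - by rewrite big_split /= -!mulr_sumr w1 w'1 !mulr1 addrC subrK.
  - rewrite !scaler_sumr -big_split /=; apply: eq_bigr => i _.
    by apply/rowP => j; rewrite !mxE; ring.
move=> _ [i _ <-]; exists (fun j => (j == i)%:R); split=> //.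
- by rewrite (bigD1 i) //= eqxx big1 ?addr0 // => j /negbTE ->.
- rewrite (bigD1 i) //= eqxx scale1r big1 ?addr0 // => j /negbTE ->.
  by rewrite scale0r.
Qed.

(** The hull is swept out by segments from x to the hull of S. The end a = x is kept apart: it
    occurs even for empty S, and t < 1 keeps the coefficient of [y] invertible. *)
Lemma conv_hull_setU1 x S a : conv_hull (x |` S) a ->
  a = x \/ exists t y, [/\ 0 <= t < 1, conv_hull S y & a = t *: x + (1 - t) *: y].
Proof.
pose C := [set a | a = x \/
  exists t y, [/\ 0 <= t < 1, conv_hull S y & a = t *: x + (1 - t) *: y]].
apply: (@conv_hull_min _ _ _ C); last first.
  move=> b [->|Sb]; [by left|right; exists 0, b; split].
  - by rewrite lexx ltr01.
  - exact: sub_conv_hull.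
  - by rewrite scale0r add0r subr0 scale1r.
move=> a1 a2 t h1 h2 /andP[t0 t1].
have [->|tn0] := eqVneq t 0; first by rewrite scale0r add0r subr0 scale1r.
have [->|tn1] := eqVneq t 1; first by rewrite scale1r subrr scale0r addr0.
have {}t0 : 0 < t by rewrite lt0r tn0.
have {}t1 : t < 1 by rewrite lt_neqAle tn1.
case: h1 h2 => [->|[r1 [y1 [/andP[r10 r11] h1 ->]]]]
  [->|[r2 [y2 [/andP[r20 r21] h2 ->]]]].
- by left; rewrite -scalerDl addrC subrK scale1r.
- right; exists (t + (1 - t) * r2), y2; split=> //; first by apply/andP; split; nra.
  by apply/rowP => i; rewrite !mxE; ring.
- right; exists (t * r1 + (1 - t)), y1; split=> //; first by apply/andP; split; nra.
  by apply/rowP => i; rewrite !mxE; ring.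
(* [r] is the total weight of x, and [c] the share of [y1] in the remaining 1 - r. *)
right; pose r := t * r1 + (1 - t) * r2.
have r0 : 0 <= r by rewrite /r; nra.
have r_lt1 : 0 < 1 - r by rewrite /r; nra.
pose c := t * (1 - r1) / (1 - r).
exists r, (c *: y1 + (1 - c) *: y2); split.
- by apply/andP; split=> //; lra.
- apply: convex_conv_hull => //; apply/andP; split.
    by rewrite divr_ge0 ?ltW //; nra.
  by rewrite /c ler_pdivrMr // /r; nra.
- by apply/rowP => i; rewrite !mxE /c /r; field; exact: lt0r_neq0 r_lt1.
Qed.

(** If x is strictly inside a segment, the ends other than x mix x with points of the hull of S;
    solving the equation for x puts x itself in that hull. *)
Lemma vertex_conv_hull_setU1 x S :
  ~ conv_hull S x -> vertex (conv_hull (x |` S)) x.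
Proof.
move=> Sx; split; first by apply: sub_conv_hull; left.
move=> a b t ha hb /andP[t0 t1].
case: (conv_hull_setU1 ha) (conv_hull_setU1 hb) =>
  [->|[r1 [y1 [/andP[r10 r11] h1 ->]]]] [->|[r2 [y2 [/andP[r20 r21] h2 ->]]]] // e;
  case: Sx.
- suff -> : x = y2 by [].
  apply/rowP => i; move/rowP/(_ i): e; rewrite !mxE => e.
  have n0 : (1 - t) * (1 - r2) != 0 by rewrite mulf_neq0 // gt_eqF; lra.
  by apply: (mulfI n0); lra.
- suff -> : x = y1 by [].
  apply/rowP => i; move/rowP/(_ i): e; rewrite !mxE => e.
  have n0 : t * (1 - r1) != 0 by rewrite mulf_neq0 // gt_eqF; lra.
  by apply: (mulfI n0); lra.
pose r := t * r1 + (1 - t) * r2.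
have r_lt1 : 0 < 1 - r by rewrite /r; nra.
pose c := t * (1 - r1) / (1 - r).
suff -> : x = c *: y1 + (1 - c) *: y2.
  apply: convex_conv_hull => //; apply/andP; split.
    by rewrite divr_ge0 ?ltW //; nra.
  by rewrite /c ler_pdivrMr // /r; nra.
apply/rowP => i; move/rowP/(_ i): e; rewrite !mxE => e.
apply: (mulfI (lt0r_neq0 r_lt1)).
transitivity (t * (1 - r1) * y1 0 i + (1 - t) * (1 - r2) * y2 0 i).
  by rewrite /r; lra.
by rewrite /c /r; field; exact: lt0r_neq0 r_lt1.
Qed.

(** A convex set minus an extreme point is still convex. Were x outside S, the hull without x would
    contain S, hence the whole hull. *)
Lemma vertex_conv_hull S x : vertex (conv_hull S) x -> S x.
Proof.
move=> [Sx hx]; apply: contrapT => nSx.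
suff h : conv_hull S `<=` conv_hull S `\ x by have [_] := h _ Sx; exact.
apply: conv_hull_min => [a b t [ha ax] [hb bx] /andP[t0 t1]|y Sy]; last first.
  by split=> [|yx]; [exact: sub_conv_hull | rewrite yx in Sy].
have [->|tn0] := eqVneq t 0; first by rewrite scale0r add0r subr0 scale1r.
have [->|tn1] := eqVneq t 1; first by rewrite scale1r subrr scale0r addr0.
split; first by apply: convex_conv_hull => //; rewrite t0.
move=> e; have [|/ax //] := hx a b t ha hb _ (esym e).
by rewrite lt0r tn0 t0 lt_neqAle tn1 t1.
Qed.

(* Once no point of s lies in the hull of the others, all of them are vertices. *)
Lemma conv_hull_vertices (s : seq vec) : s != [::] ->
  exists s' : seq vec, [/\ s' != [::], conv_hull [set` s] = conv_hull [set` s'] &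
    forall x, x \in s' -> vertex (conv_hull [set` s]) x].
Proof.
have [n] := ubnP (size s); elim: n s => // n IH s sn s0.
have rem_set x : x \in s -> [set` s] = x |` [set` rem x s].
  move=> xs; apply/seteqP; split=> y /=.
    by rewrite (perm_mem (perm_to_rem xs)) inE => /orP[/eqP ->|]; [left|right].
  by move=> [->|/mem_rem].
have [[x [xs hx]]|h] := pselect (exists x, x \in s /\ conv_hull [set` rem x s] x).
  have e : conv_hull [set` s] = conv_hull [set` rem x s].
    rewrite (rem_set _ xs); apply/seteqP; split; apply: sub_conv_hull2.
      by move=> y [->//|]; exact: sub_conv_hull.
    by move=> y ys; apply: sub_conv_hull; right.
  rewrite e; apply: IH.
    by rewrite size_rem //; case: (s) s0 sn.
  by apply: contraPneq hx => ->; rewrite set_nil conv_hull0.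
exists s; split=> // x xs; rewrite (rem_set _ xs).
by apply: vertex_conv_hull_setU1 => hx; apply: h; exists x.
Qed.

Lemma polytope_vertices (P : set vec) : polytope P ->
  exists s : seq vec, [/\ s != [::], P = conv_hull [set` s] &
    forall x, x \in s -> vertex P x].
Proof.
by move=> [s [s0 ->]]; have [s' [? ? ?]] := conv_hull_vertices s0; exists s'.
Qed.

(** * Newton polyhedra and integral closure *)

Lemma nat_vecD (u v : 'X_{1..d}) : nat_vec R (u + v)%MM = nat_vec R u + nat_vec R v.
Proof. by apply/rowP => i; rewrite !mxE mnmDE natrD. Qed.

Lemma orthant_nat_vec (u : 'X_{1..d}) : orthant (nat_vec R u).
Proof. by move=> i; rewrite !mxE ler0n. Qed.

Definition orthant_exps (P : set vec) : set 'X_{1..d} :=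
  [set m | minkowski P orthant (nat_vec R m)].

(** y dominates a sum of n+1 elements of D, so y/(n+1) dominates their mean, a point of C. Counting
    starts at one since [nfold D 0] is everything. *)
Lemma nfold_mean C (D : set 'X_{1..d}) n (y : 'X_{1..d}) :
  convex C -> nat_vec R @` D `<=` C ->
  nfold D n.+1 y -> minkowski C orthant (n.+1%:R^-1 *: nat_vec R y).
Proof.
move=> cC DC; have cK := convex_minkowski cC convex_orthant.
elim: n y => [|n IH] _ [e [m [De hm ->]]].
  exists (nat_vec R e); first by apply: DC; exists e.
  exists (nat_vec R m); first exact: orthant_nat_vec.
  by rewrite invr1 scale1r nat_vecD.
(* A mean of n+2 points gives weight 1/(n+2) to the new point and the rest to the mean of the
   others. *)
pose t : R := n.+2%:R^-1.
have -> : n.+2%:R^-1 *: nat_vec R (e + m)%MM =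
    t *: nat_vec R e + (1 - t) *: (n.+1%:R^-1 *: nat_vec R m).
  have n0 : (0 : R) <= n%:R by rewrite ler0n.
  apply/rowP => i; rewrite !mxE mnmDE natrD /t -[n.+2]addn2 -[n.+1]addn1 !natrD.
  by field; apply/andP; split; rewrite gt_eqF //; lra.
apply: cK; [|exact: IH|].
- exists (nat_vec R e); first by apply: DC; exists e.
  by exists 0; rewrite ?addr0 // => i; rewrite mxE.
- by rewrite invr_ge0 ler0n invf_le1 ?ltr0n // ler1n.
Qed.

Lemma orthant_exps_conv_hull (l : seq 'X_{1..d}) :
  orthant_exps (conv_hull (nat_vec R @` [set` l])) = sat [set` l].
Proof.
apply/seteqP; split=> m; last first.
  move=> [[|n] [n0 hn]] //.
  have := nfold_mean (@convex_conv_hull _ _ _) (@sub_conv_hull _ _ _) hn.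
  congr minkowski; apply/rowP => i; rewrite !mxE mulmnE natrM mulrCA.
  by rewrite mulVf ?mulr1 // pnatr_eq0.
have -> : [set` l] = range (tnth (in_tuple l)).
  apply/seteqP; split=> u /=; first by move=> /(tnthP (in_tuple l))[i ->]; exists i.
  by move=> [i _ <-]; exact: mem_tnth.
rewrite image_comp => -[_ /conv_hull_weights[w [w0 w1 ->]] [o ho e]].
apply: (sat_of_weights w0 w1) => j; move/rowP/(_ j): e; rewrite !mxE => <-.
rewrite summxE -[leLHS]addr0 lerD //.
by apply: ler_sum => i _; rewrite !mxE.
Qed.

Lemma nat_polytope (P : set vec) : polytope P ->
  (forall x, vertex P x -> exists m, x = nat_vec R m) ->
  exists l : seq 'X_{1..d}, l != [::] /\ P = conv_hull (nat_vec R @` [set` l]).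
Proof.
move=> /polytope_vertices[s [s0 -> sP]] hP.
have /choice[f hf] x : exists m, x \in s -> x = nat_vec R m.
  by case: (boolP (x \in s)) => [/sP/hP[m ->]|_]; [exists m | exists 0%MM].
exists (map f s); split; first by case: (s) s0.
congr conv_hull; apply/seteqP; split=> x.
  by move=> /= xs; exists (f x); rewrite -?hf //=; exact: map_f.
by move=> [_ /= /mapP[y ys ->] <-]; rewrite -hf.
Qed.

End ConvexHulls.

(** * Universal properties of the Grothendieck group and of the quotient *)

Lemma grothendieck_lift (M : nmodType) (V : zmodType) (f : M -> V) :
  f 0 = 0 -> {morph f : a b / a + b} ->
  exists g : {additive grothendieck M -> V},
    forall a b, g (\pi_(grothendieck M) (a, b)) = f a - f b.
Proof.
move=> f0 fD; pose g (x : grothendieck M) := f (repr x).1 - f (repr x).2.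
have gE a b : g (\pi_(grothendieck M) (a, b)) = f a - f b.
  have [c /= e] := gro_repr_rel (a, b); move: (congr1 f e); rewrite !fD /g.
  move=> /addIr {}e; apply/eqP; rewrite subr_eq addrAC -e.
  by rewrite addrK.
have g_add : zmod_morphism g.
  elim/groW=> -[a b]; elim/groW=> -[a' b'].
  have -> : \pi_(grothendieck M) (a, b) - \pi_(grothendieck M) (a', b') =
      \pi_(grothendieck M) (a + b', b + a').
    transitivity (gro_add (\pi_(grothendieck M) (a, b))
      (gro_opp (\pi_(grothendieck M) (a', b')))) => //.
    by rewrite gro_opp_pi gro_add_pi.
  by rewrite !gE !fD opprB opprD addrACA.
pose gA : {additive grothendieck M -> V} :=
  HB.pack g (GRing.isZmodMorphism.Build _ _ g g_add).
by exists gA.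
Qed.

(** The kernel of g is a subgroup containing S, hence contains the subgroup generated by S. *)
Lemma quot_gen_lift (V W : zmodType) (S : set V) (g : {additive V -> W}) :
  (forall s, S s -> g s = 0) ->
  exists h : {additive quot_gen S -> W}, forall x, h (quot_class S x) = g x.
Proof.
move=> gS; pose h (x : quot_gen S) := g (repr x).
have gen0 x : x \in gen_subgroup S -> g x = 0.
  move=> /asboolP/(_ [set y | g y = 0]) /=; apply; split=> //; split=> /=.
    exact: raddf0.
  by move=> a b ga gb; rewrite raddfB ga gb subrr.
have hE x : h (quot_class S x) = g x.
  apply/eqP; rewrite -subr_eq0 -raddfB; apply/eqP/gen0.
  by rewrite Quotient.idealrBE; apply/eqP; rewrite reprK.
have h_add : zmod_morphism h.
  move=> x y; rewrite -[x]reprK -[y]reprK.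
  have -> : \pi_(quot_gen S) (repr x) - \pi_(quot_gen S) (repr y) =
    quot_class S (repr x - repr y) by rewrite /quot_class raddfB.
  by rewrite hE !(hE _ : h (\pi _) = _) raddfB.
pose hA : {additive quot_gen S -> W} :=
  HB.pack h (GRing.isZmodMorphism.Build _ _ h h_add).
by exists hA.
Qed.

(** * From integral polytopes to classes of ideals *)

Section PolytopeIdeals.
Variables (R : realType) (d : nat).
Implicit Types (P Q : int_polytope R d) (u v : 'X_{1..d}) (z : 'rV[int]_d).

Definition in_orthant P : Prop :=
  forall x, vertex P x -> exists m, x = nat_vec R m.

Definition int_mnm u : 'rV[int]_d := \row_i (u i)%:Z.

Lemma int_vec_mnm u : int_vec R (int_mnm u) = nat_vec R u.
Proof. by apply/rowP => i; rewrite !mxE. Qed.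

Lemma point_polytopeD z z' :
  point_polytope R (z + z') = point_polytope R z + point_polytope R z'.
Proof.
apply: int_polytope_inj; rewrite /= /int_vec map_mxD.
apply/seteqP; split=> [x ->|_ [_ -> [_ -> <-]]] //.
by exists (int_vec R z) => //; exists (int_vec R z').
Qed.

Lemma translate_polytope z P : translate z P = P + point_polytope R z.
Proof.
apply/seteqP; split=> [_ [x Px <-]|_ [x Px [_ -> <-]]]; last by exists x.
by exists x => //; exists (int_vec R z).
Qed.

Lemma in_orthantD P Q : in_orthant P -> in_orthant Q -> in_orthant (P + Q).
Proof.
move=> hP hQ _ /vertex_minkowski[_ [_ [/hP[u ->] /hQ[v ->] ->]]].
by exists (u + v)%MM; rewrite nat_vecD.
Qed.

Lemma in_orthant_point u : in_orthant (point_polytope R (int_mnm u)).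
Proof. by move=> _ [-> _]; exists u; rewrite int_vec_mnm. Qed.

Lemma in_orthantP P : in_orthant P -> exists l : seq 'X_{1..d},
  l != [::] /\ polytope_set P = conv_hull (nat_vec R @` [set` l]).
Proof. by move=> hP; exact: nat_polytope (int_polytopeP P).1 hP. Qed.

Lemma orthant_expsP P : in_orthant P ->
  sat (orthant_exps P) = orthant_exps P /\ exists m, orthant_exps P m.
Proof.
move=> /in_orthantP[l [l0 ->]]; rewrite orthant_exps_conv_hull sat_sat.
split=> //; case: l l0 => // m l _; exists m; apply: sub_sat.
exact: mem_head.
Qed.

(** The Minkowski sum of two hulls is the hull of the pairwise sums, and [sat] absorbs saturations
    of the summands. *)
Lemma orthant_expsD P Q : in_orthant P -> in_orthant Q ->
  orthant_exps (P + Q) = sat (exp_add (orthant_exps P) (orthant_exps Q)).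
Proof.
move=> /in_orthantP[l [_ eP]] /in_orthantP[l' [_ eQ]].
rewrite [polytope_set (P + Q)]/= eP eQ conv_hull_minkowski.
have -> : minkowski (nat_vec R @` [set` l]) (nat_vec R @` [set` l']) =
    nat_vec R @` [set` [seq (u + v)%MM | u <- l, v <- l']].
  apply/seteqP; split.
    move=> _ [_ [u ul <-] [_ [v vl <-] <-]]; exists (u + v)%MM.
      exact: allpairs_f.
    exact: nat_vecD.
  move=> _ [_ /allpairsP[[u v] [ul vl ->]] <-]; rewrite nat_vecD.
  by exists (nat_vec R u); [exists u|exists (nat_vec R v) => //; exists v].
rewrite !orthant_exps_conv_hull sat_exp_add_satl sat_exp_add_satr; congr sat.
apply/seteqP; split=> m.
  by move=> /allpairsP[[u v] [ul vl ->]]; exists u, v.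
by move=> [u [v [ul vl ->]]]; exact: allpairs_f.
Qed.

(** The point u carries the principal ideal (x^u), so this is a case of [orthant_expsD]. *)
Lemma orthant_exps_shift P u : in_orthant P ->
  orthant_exps (P + point_polytope R (int_mnm u)) = shift_exp u (orthant_exps P).
Proof.
move=> hP; rewrite orthant_expsD //; last exact: in_orthant_point.
have -> : orthant_exps (point_polytope R (int_mnm u)) = sat [set` [:: u]].
  rewrite -(orthant_exps_conv_hull R).
  have -> : nat_vec R @` [set` [:: u]] = [set nat_vec R u].
    apply/seteqP; split=> [_ [v /= + <-]|_ ->]; last by exists u; rewrite //= mem_head.
    by rewrite inE => /eqP ->.
  by rewrite conv_hull_id -?int_vec_mnm //; exact: convex_set1.
have [sP _] := orthant_expsP hP.
rewrite sat_exp_add_satr -[in RHS]sP -sat_shift; congr sat.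
apply/seteqP; split=> m.
  move=> [v [w [hv /= + ->]]]; rewrite inE => /eqP ->; exists v => //.
  exact: addmC.
by move=> [v hv ->]; exists v, u; rewrite addmC; split=> //=; rewrite mem_head.
Qed.

Lemma translate_in_orthant P : exists z, in_orthant (P + point_polytope R z).
Proof.
have [s [_ eP sP]] := polytope_vertices (int_polytopeP P).1.
have /choice[f hf] x : exists z, x \in s -> x = int_vec R z.
  by case: (boolP (x \in s)) => [/sP/(int_polytopeP P).2[z ->]|_]; [exists z|exists 0].
(* The sum over all vertices compensates the negative coordinates of each of them at once. *)
exists (\row_i \sum_(x <- s) `|f x 0 i|).
move=> _ /vertex_minkowski[x [_ [vx [-> _] ->]]].
have xs : x \in s by apply: (vertex_conv_hull (S := [set` s])); rewrite -eP.
have h i : 0 <= f x 0 i + \sum_(y <- s) `|f y 0 i|.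
  rewrite (big_rem x) //= addrA addr_ge0 ?sumr_ge0 //; lia.
exists [multinom `|(f x 0 i + \sum_(y <- s) `|f y 0 i|)%R|%N | i < d].
rewrite {1}(hf x xs); apply/rowP => i; rewrite !mxE mnmE.
by rewrite natr_absz ger0_norm // intrD.
Qed.

Variables (k : fieldType) (A : coef_ring k d).

(* The class of the monomial ideal attached to some translate of P into the *)
(* orthant is x; as any two such translates become equal after further      *)
(* translations by natural vectors, x depends only on P.                    *)
Definition represents P (x : ic_quot A) : Prop :=
  exists z (I : ic_ideal A), [/\ in_orthant (P + point_polytope R z),
    exps I = orthant_exps (P + point_polytope R z) & x = \pi_(ic_quot A) I].

Lemma in_orthant_ideal P : in_orthant P ->
  exists I : ic_ideal A, I = mon_ideal A (orthant_exps P) :> set A /\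
    exps I = orthant_exps P.
Proof.
move=> /orthant_expsP[sP [m Pm]].
exists (IcIdeal (asboolT (ic_mon_mon_ideal A sP Pm))); split=> //=.
by rewrite exps_mon_ideal -{1}sP up_sat.
Qed.

Lemma represents_ex P : exists x, represents P x.
Proof.
have [z hz] := translate_in_orthant P; have [I [_ eI]] := in_orthant_ideal hz.
by exists (\pi_(ic_quot A) I), z, I.
Qed.

Lemma represents_uniq P x y : represents P x -> represents P y -> x = y.
Proof.
move=> [z [I [hz eI ->]]] [z' [J [hz' eJ ->]]].
apply/eqmodP/ic_simP.
(* Only natural shifts are monomials, so z' - z is written as u - v, with v = |z'| + |z|
   coordinatewise. *)
have [u [v uv]] : exists u v, z + int_mnm u = z' + int_mnm v.
  exists [multinom `|(`|z' 0 i| + z' 0 i + (`|z 0 i| - z 0 i))%R|%N | i < d].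
  exists [multinom `|(`|z' 0 i| + `|z 0 i|)%R|%N | i < d].
  apply/rowP => i; rewrite !mxE !mnmE.
  by move: (z 0 i) (z' 0 i) => a b; lia.
exists u, v; rewrite eI eJ -!orthant_exps_shift //.
by rewrite -!addrA -!point_polytopeD uv.
Qed.

Lemma representsD P Q x y :
  represents P x -> represents Q y -> represents (P + Q) (x + y).
Proof.
move=> [z [I [hz eI ->]]] [z' [J [hz' eJ ->]]]; exists (z + z'), (I + J).
rewrite point_polytopeD addrACA; split; first exact: in_orthantD.
  by rewrite exps_ic_mul eI eJ [RHS]orthant_expsD.
exact: ic_quot_add_pi.
Qed.

(** Translation by -z moves the point to the origin, whose polyhedron is the whole orthant; this is
    the unit ideal, the zero of the monoid. *)
Lemma represents_point z : represents (point_polytope R z) 0.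
Proof.
exists (- z), 0; rewrite -point_polytopeD subrr.
have e0 : 0 = int_mnm 0%MM by apply/rowP => i; rewrite !mxE mnm0E.
split=> //; rewrite {1}e0; first exact: in_orthant_point.
apply/seteqP; split=> // m _; exists 0; first by rewrite -e0 /= /int_vec map_mx0.
by exists (nat_vec R m); [exact: orthant_nat_vec | rewrite add0r].
Qed.

(** Dickson's lemma gives finitely many exponents generating I. Since I is integrally closed,
    [exps I] is their saturation, hence the exponent set of their hull. *)
Lemma polytope_of_ideal (I : ic_ideal A) : exists P, represents P (\pi_(ic_quot A) I).
Proof.
have [_ sI [m Im]] := ic_monP (ic_idealP I).
have [l [lI Il]] := dickson (exps I).
have l0 : l != [::].
  by apply: contraPneq (Il _ Im) => -> /upP[e [v []]].
have vP x : vertex (conv_hull (nat_vec R @` [set` l])) x ->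
    exists m, x = nat_vec R m.
  by move=> /vertex_conv_hull[u _ <-]; exists u.
have iP : integral_polytope (conv_hull (nat_vec R @` [set` l])).
  split; last by move=> x /vP[u ->]; exists (int_mnm u); rewrite int_vec_mnm.
  exists (map (nat_vec R) l); split; first by case: (l) l0.
  congr conv_hull; apply/seteqP; split=> [_ [u ul <-]|_ /= /mapP[u ul ->]].
    exact: map_f.
  by exists u.
exists (IntPolytope (asboolT iP)), 0, I.
have -> : point_polytope R 0 = 0 :> int_polytope R d by [].
rewrite addr0; split=> //=; rewrite orthant_exps_conv_hull.
rewrite -sI; apply/seteqP; split; apply: sat_min; last first.
  by move=> u ul; apply: sub_sat; exact: lI.
by move=> u /Il ul; rewrite -up_sat; case: ul => e el eu; exists e => //; exact: sub_sat.
Qed.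

End PolytopeIdeals.

Theorem theorem1p4 (R : realType) (k : fieldType) (d : nat) (A : coef_ring k d)
    (hA : A = polynomial_ring k d \/ A = power_series_ring k d) :
  exists phi : {additive polytope_group_t R d -> ic_group A},
    (forall y : ic_group A, exists x : polytope_group_t R d, phi x = y) /\
    forall (P : int_polytope R d) (z : 'rV[int]_d),
      (forall x : 'rV[R]_d, vertex (translate z P) x ->
         exists m : 'X_{1..d}, x = nat_vec R m) ->
      exists I : ic_ideal A,
        (I : set A) = mon_ideal A
          [set m | minkowski (translate z P) orthant (nat_vec R m)] /\
        phi (polytope_class P) = ic_class I.
Proof.
have /choice[f fP] := @represents_ex R d k A.
have fE P x : represents P x -> f P = x by exact: represents_uniq.
have cD x y : gro_class (x + y) = gro_class x + gro_class y :> ic_group A.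
  transitivity (gro_add (gro_class x) (gro_class y)) => //.
  by rewrite gro_add_pi /= addr0.
have fp z : f (point_polytope R z) = 0 by apply/fE/represents_point.
have [||g gE] := @grothendieck_lift (int_polytope R d) (ic_group A)
  (fun P => gro_class (f P)).
- by rewrite /= (fp 0).
- by move=> P Q /=; rewrite -cD; congr gro_class; apply/fE/representsD.
have gc P : g (gro_class P) = gro_class (f P).
  by rewrite gE /= (fp 0); exact: subr0.
have [|phi phiE] := @quot_gen_lift _ _
    [set gro_class (point_polytope R z) | z in [set: 'rV[int]_d]] g.
  by move=> _ [z _ <-]; rewrite gc fp.
exists phi; split.
(* Each element of [ic_group] is a difference of two ideal classes, and each of these comes from a
   polytope. *)
- elim/groW=> -[]; elim/ic_quotW=> I; elim/ic_quotW=> J.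
  have [P hP] := @polytope_of_ideal R d k A I.
  have [Q hQ] := @polytope_of_ideal R d k A J.
  exists (polytope_class P - polytope_class Q).
  rewrite raddfB !phiE !gc (fE _ _ hP) (fE _ _ hQ).
  transitivity (gro_add (gro_class (\pi_(ic_quot A) I))
    (gro_opp (gro_class (\pi_(ic_quot A) J)))) => //.
  by rewrite gro_opp_pi gro_add_pi /= addr0 add0r.
(* [represents] admits every translate into the orthant, so the given z determines [f P]. *)
move=> P z; rewrite translate_polytope => hP.
have [I [eI xI]] := in_orthant_ideal A hP; exists I; split=> //.
by rewrite phiE gc; congr gro_class; apply: fE; exists z, I.
Qed.
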